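(* If $I\subseteq\mathbb{N}$ satisfies $$\limsup_{N\to\infty}\frac{\log\#(I\cap[1,N])}{\log N}=1,$$ then, writing $h=\dim_{\mathrm H}F_I$, for all $\theta\in(0,1)$ we have $$\dim_{\mathrm A}^\theta F_I=\begin{cases}h+\frac{\theta}{1-\theta}(1-h),&\theta<1/2,\\ 1,&\theta\ge1/2.\end{cases}$$
   Context: $\mathbb{N}=\{1,2,3,\dots\}$, $\#$ denotes cardinality, and $\dim_{\mathrm H}$ is Hausdorff dimension. For a non-empty $I\subseteq\mathbb{N}$, $$F_I=\left\{z\in(0,1)\setminus\mathbb{Q}:\ z=\cfrac{1}{b_1+\cfrac{1}{b_2+\cfrac{1}{\ddots}}},\ b_n\in I\text{ for all }n\in\mathbb{N}\right\}.$$ For a non-empty bounded set $E\subset\mathbb{R}$ and $\theta\in(0,1)$, the Assouad spectrum is $\dim_{\mathrm A}^\theta E=\inf\{\alpha:\exists C>0\ \forall x\in E\ \forall\,0<R\le1,\ N_{R^{1/\theta}}(B(x,R)\cap E)\le CR^{\alpha(1-1/\theta)}\}$, where $B(x,R)$ is the open ball and $N_r(\cdot)$ is the smallest number of balls of radius $r$ needed to cover a set. *)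

(* Defs.v *)
From mathcomp Require Import all_boot all_order all_algebra.
From mathcomp Require Import finmap.
From mathcomp Require Import all_classical all_reals all_analysis.

Set Implicit Arguments.
Unset Strict Implicit.
Unset Printing Implicit Defensive.

Import Order.TTheory GRing.Theory Num.Theory.
Import numFieldNormedType.Exports.

Local Open Scope classical_set_scope.
Local Open Scope ring_scope.

(* [cf_trunc R b n] is 1/(b 0 + 1/(b 1 + ... + 1/b (n-1))).  Partial quotients
   are indexed from 0 here: [b n] stands for b_{n+1}. *)
Fixpoint cf_trunc (R : realType) (b : nat -> nat) (n : nat) : R :=
  if n is m.+1 then ((b 0%N)%:R + cf_trunc R (fun k => b k.+1) m)^-1 else 0.

(* The continued fraction with digits in [I]; an infinite continued fraction
   is the limit of its truncations.  Meaningful when [I] contains only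
   positive numbers. *)
Definition cf_set (R : realType) (I : set nat) : set R :=
  [set z : R | 0 < z < 1 /\ irrational z /\
    exists b : nat -> nat, (forall n, I (b n)) /\
      cf_trunc R b n @[n --> \oo] --> z].
Arguments cf_set R I : clear implicits.

(* For [E = set0] the value is [-oo]; see [hausdorff_gauge]. *)
Definition diam (R : realType) (E : set R) : \bar R :=
  ereal_sup [set `|p.1 - p.2|%:E | p in E `*` E].

(* Conventions at the boundary: the empty set contributes 0 for every s, and
   a singleton contributes 1 for s = 0 since [0 `^ 0 = 1]. *)
Definition hausdorff_gauge (R : realType) (s : R) (U : set R) : \bar R :=
  if U == set0 then 0%E else poweR (diam U) s.

Definition hausdorff_pre (R : realType) (s delta : R) (E : set R) : \bar R :=
  ereal_inf [set (\sum_(i <oo) hausdorff_gauge s (U i))%E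
            | U in [set U : nat -> set R |
                     (forall i, (diam (U i) <= delta%:E)%E) /\
                     E `<=` \bigcup_i U i]].

Definition hausdorff_measure (R : realType) (s : R) (E : set R) : \bar R :=
  ereal_sup [set hausdorff_pre s delta E | delta in [set delta : R | 0 < delta]].

Definition hausdorff_dim (R : realType) (E : set R) : \bar R :=
  ereal_inf [set s%:E | s in
    [set s : R | 0 <= s /\ hausdorff_measure s E = 0%E]].

(* [+oo] when no finite cover exists; centres range over the whole line. *)
Definition covering_number (R : realType) (r : R) (A : set R) : \bar R :=
  ereal_inf [set n%:R%:E | n in
    [set n : nat | exists c : nat -> R, A `<=` \bigcup_(i < n) ball (c i) r]].

Definition assouad_spectrum (R : realType) (theta : R) (E : set R) : \bar R :=
  ereal_inf [set alpha%:E | alpha in [set alpha : R |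
    exists C : R, 0 < C /\
      forall x r : R, E x -> 0 < r <= 1 ->
        (covering_number (r `^ theta^-1) (ball x r `&` E)
           <= (C * r `^ (alpha * (1 - theta^-1)))%:E)%E]].

(* #(I /\ [1,N]) *)
Definition count_upto (I : set nat) (N : nat) : nat :=
  #|` fset_set (I `&` [set k | (1 <= k <= N)%N])|.

(* Main.v *)
(* For a word w of partial quotients let S_w be the corresponding Moebius map and
   |w| = q_w^-2 the size of its cylinder, and let h be the Hausdorff dimension
   of F = F_I.

   If H^{s'}(F) = 0 and s > s', then for a finite subalphabet the sum of
   (|w|/4)^s over the words of any fixed length is below 1: otherwise the limit
   set of these words would have positive s-dimensional measure. So the sum of
   |w|^s over all words converges for s > h; as I is dense along a subsequence
   of scales, the words of length 1 give h >= 1/2. Cutting every expansion at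
   the first cylinder smaller than rho covers F by O(rho^-s) sets of size rho:
   the points of the cylinder of u whose next digit jumps below rho form an
   interval of length O((|u| rho)^(1/2)), and (|u|/rho)^(1/2) <= (|u|/rho)^s.

   In a ball of radius r with rho <= r^2 one first cuts at scale r. Cylinders of
   a given length are disjoint, so O(1) of those of size at least r meet the
   ball, and the smaller ones have total length O(r) on each of the O(log 1/r)
   levels. This gives r^-1 (r^2/rho)^s sets up to logarithms, which is the upper
   bound at rho = r^(1/theta), theta < 1/2.

   Conversely, if I has at least N^(1-e) elements up to N, a ball of radius
   N^(2e-1) contains about N^(1-e) cylinders of words of length 1, all of size at
   least N^-2. Each of them needs about (N^-2/rho)^s sets for s < h when
   rho < N^-2, and otherwise a set of size rho meets O(rho N^2) of them. *)

Require Import Defs.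
From mathcomp Require Import all_boot all_order all_algebra.
From mathcomp Require Import finmap.
From mathcomp Require Import all_classical all_reals all_analysis.
From mathcomp Require Import ring lra zify.

Set Implicit Arguments.
Unset Strict Implicit.
Unset Printing Implicit Defensive.

Import Order.TTheory GRing.Theory Num.Theory.
Import numFieldNormedType.Exports.

Local Open Scope classical_set_scope.
Local Open Scope ring_scope.

(** * Words and cylinders *)

Section Words.
Variable R : realType.
Implicit Types (w u v : seq nat) (x y : R).

Fixpoint moeb w x : R := if w is n :: w' then (n%:R + moeb w' x)^-1 else x.

(* The difference of two values of [moeb w] is, up to sign,
   (x - y) / (den w x * den w y); [den w 0] is the continuant of [w]. *)
Fixpoint den w x : R :=
  if w is n :: w' then den w' x * (n%:R + moeb w' x) else 1.

(** With [den] it satisfies the recursion of continuants ([den_cons], [num_cons]); for positive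
    digits both are affine in [x] with nonnegative coefficients. *)
Definition num w x : R := moeb w x * den w x.

Definition cyl w : R := (den w 0) ^- 2.

Definition posw w := all (fun n => 0 < n)%N w.

Lemma moeb_itv w x : posw w -> 0 <= x <= 1 -> 0 <= moeb w x <= 1.
Proof.
elim: w => //= n w IH /andP[n0 /IH] + /[dup] x01 => /[apply] /andP[m0 m1].
have n1 : (1 : R) <= n%:R by rewrite ler1n.
rewrite invr_ge0 invf_le1; lra.
Qed.

Lemma den_ge1 w x : posw w -> 0 <= x <= 1 -> 1 <= den w x.
Proof.
elim: w => //= n w IH /andP[n0 pw] x01.
have /andP[m0 m1] := moeb_itv pw x01.
have n1 : (1 : R) <= n%:R by rewrite ler1n.
have d1 := IH pw x01.
by rewrite -[leLHS]mulr1; apply: ler_pM => //; lra.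
Qed.

Lemma den_gt0 w x : posw w -> 0 <= x <= 1 -> 0 < den w x.
Proof. by move=> pw x01; apply: lt_le_trans (den_ge1 pw x01). Qed.

Lemma den_cons n w x : den (n :: w) x = n%:R * den w x + num w x.
Proof. by rewrite /num /=; ring. Qed.

Lemma num_cons n w x : (0 < n)%N -> posw w -> 0 <= x <= 1 ->
  num (n :: w) x = den w x.
Proof.
move=> n0 pw x01; have /andP[m0 m1] := moeb_itv pw x01.
have n1 : (1 : R) <= n%:R by rewrite ler1n.
rewrite /num /= mulrCA mulVf ?mulr1 //.
by apply: lt0r_neq0; lra.
Qed.

Lemma num_ge0 w x : posw w -> 0 <= x <= 1 -> 0 <= num w x.
Proof.
move=> pw x01; have /andP[m0 m1] := moeb_itv pw x01.
by rewrite mulr_ge0 // ltW // den_gt0.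
Qed.

Lemma moeb_cat u v x : moeb (u ++ v) x = moeb u (moeb v x).
Proof. by elim: u => //= n u ->. Qed.

Lemma den_cat u v x : den (u ++ v) x = den u (moeb v x) * den v x.
Proof. by elim: u => [|n u IH] /=; rewrite ?mul1r // IH moeb_cat mulrAC. Qed.

Lemma den_num_mono w x y : posw w -> 0 <= x -> x <= y -> y <= 1 ->
  den w x <= den w y /\ num w x <= num w y.
Proof.
move=> + x0 xy y1; elim: w => [|n w IH] /=; first by rewrite /num /= !mulr1.
move=> /andP[n0 pw]; have [d p] := IH pw.
rewrite !num_cons // ?(x0, le_trans xy y1, y1, le_trans x0 xy) //; split => //.
by rewrite -/(den (n :: w) x) -/(den (n :: w) y) !den_cons lerD // ler_wpM2l.
Qed.

Lemma den_le w x : posw w -> 0 <= x <= 1 -> den w 0 <= den w x.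
Proof. by move=> pw /andP[x0 x1]; have [] := @den_num_mono w 0 x. Qed.

(* The sum [den + num] has to be carried along for the induction. *)
Lemma den_distortion w x y : posw w -> 0 <= x <= 1 -> 0 <= y <= 1 ->
  den w y <= 2 * den w x.
Proof.
move=> pw x01 y01; move: (x01) (y01) => /andP[x0 x1] /andP[y0 y1].
suff [] : den w y <= 2 * den w x /\
  den w y + num w y <= 2 * (den w x + num w x) by [].
elim: w pw => [|n w IH] /=; first by rewrite /num /= !mulr1; lra.
move=> /andP[n0 pw]; have [d p] := IH pw.
rewrite !num_cons // -/(den (n :: w) x) -/(den (n :: w) y) !den_cons.
have n1 : (1 : R) <= n%:R by rewrite ler1n.
have : (n%:R - 1) * den w y <= (n%:R - 1) * (2 * den w x).
  by rewrite ler_wpM2l // subr_ge0.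
by lra.
Qed.

Lemma itv01_0 : 0 <= (0 : R) <= 1. Proof. lra. Qed.
Lemma itv01_1 : 0 <= (1 : R) <= 1. Proof. lra. Qed.
Hint Resolve itv01_0 itv01_1 : core.

Lemma cyl_gt0 w : posw w -> 0 < cyl w.
Proof. by move=> pw; rewrite invr_gt0 exprn_gt0 // den_gt0. Qed.

Lemma cyl_le1 w : posw w -> cyl w <= 1.
Proof.
by move=> pw; rewrite invf_le1 ?exprn_gt0 ?den_gt0 // exprn_ege1 // den_ge1.
Qed.

Lemma cyl_nil : cyl [::] = 1.
Proof. by rewrite /cyl /= expr1n invr1. Qed.

Lemma cyl1 n : cyl [:: n] = n%:R ^- 2.
Proof. by rewrite /cyl /= addr0 mul1r. Qed.

Lemma moebB w x y : posw w -> 0 <= x <= 1 -> 0 <= y <= 1 ->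
  moeb w x - moeb w y = (-1) ^+ size w * (x - y) / (den w x * den w y).
Proof.
move=> + x01 y01; elim: w => [|n w IH] /=.
  by rewrite expr0 !mul1r invr1 mulr1.
move=> /andP[n0 pw].
have n1 : (1 : R) <= n%:R by rewrite ler1n.
have /andP[mx0 mx1] := moeb_itv pw x01.
have /andP[my0 my1] := moeb_itv pw y01.
have dx := den_gt0 pw x01; have dy := den_gt0 pw y01.
have E : (n%:R + moeb w x)^-1 - (n%:R + moeb w y)^-1 =
   - (moeb w x - moeb w y) / ((n%:R + moeb w x) * (n%:R + moeb w y)).
  by field; apply/andP; split; lra.
rewrite E IH // exprS; field.
by repeat (apply/andP; split); lra.
Qed.

Lemma moeb_dist w x y : posw w -> 0 <= x <= 1 -> 0 <= y <= 1 ->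
  `|moeb w x - moeb w y| = `|x - y| / (den w x * den w y).
Proof.
move=> pw x01 y01; rewrite moebB // !normrM normrX normrN1 expr1n mul1r.
by congr (_ * _); rewrite ger0_norm // invr_ge0 mulr_ge0 // ltW // den_gt0.
Qed.

Lemma moeb_dist_le w x y : posw w -> 0 <= x <= 1 -> 0 <= y <= 1 ->
  `|moeb w x - moeb w y| <= cyl w * `|x - y|.
Proof.
move=> pw x01 y01; rewrite moeb_dist // mulrC ler_wpM2r //.
have d0 := den_gt0 pw itv01_0.
rewrite lef_pV2 ?posrE ?mulr_gt0 ?exprn_gt0 ?den_gt0 // expr2.
by apply: ler_pM; rewrite ?den_le // ltW.
Qed.

Lemma moeb_dist_ge w x y : posw w -> 0 <= x <= 1 -> 0 <= y <= 1 ->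
  cyl w / 4 * `|x - y| <= `|moeb w x - moeb w y|.
Proof.
move=> pw x01 y01; rewrite moeb_dist // [leRHS]mulrC ler_wpM2r //.
have d0 := den_gt0 pw itv01_0.
rewrite -invfM lef_pV2 ?posrE ?mulr_gt0 ?exprn_gt0 ?den_gt0 //.
have -> : den w 0 ^+ 2 * 4 = (2 * den w 0) * (2 * den w 0) by ring.
by apply: ler_pM; rewrite ?den_distortion // ltW // den_gt0.
Qed.

Lemma moeb_len_ge w : posw w -> cyl w / 2 <= `|moeb w 0 - moeb w 1|.
Proof.
move=> pw; rewrite moeb_dist // sub0r normrN normr1 mul1r.
have d0 := den_gt0 pw itv01_0.
rewrite -invfM lef_pV2 ?posrE ?mulr_gt0 ?exprn_gt0 ?den_gt0 //.
have -> : den w 0 ^+ 2 * 2 = den w 0 * (2 * den w 0) by ring.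
by rewrite ler_pM2l // den_distortion.
Qed.

Lemma cyl_cat_le u v : posw u -> posw v -> cyl (u ++ v) <= cyl u * cyl v.
Proof.
move=> pu pv; rewrite /cyl den_cat exprMn invfM.
have v0 := moeb_itv pv itv01_0.
rewrite ler_wpM2r ?invr_ge0 ?exprn_ge0 ?(ltW (den_gt0 pv _)) //.
rewrite lef_pV2 ?posrE ?exprn_gt0 ?den_gt0 // lerXn2r ?nnegrE //.
- by rewrite ltW ?den_gt0.
- by rewrite ltW ?den_gt0.
- exact: den_le.
Qed.

(** [den (u ++ v) 0] is [den v 0] times a value of [den u], which distortion keeps within a factor 2
    of [den u 0]; squaring gives the 4. *)
Lemma cyl_cat_ge u v : posw u -> posw v -> cyl u * cyl v / 4 <= cyl (u ++ v).
Proof.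
move=> pu pv; rewrite /cyl den_cat exprMn [in leRHS]invfM mulrAC.
have v0 := moeb_itv pv itv01_0.
rewrite ler_wpM2r ?invr_ge0 ?exprn_ge0 ?(ltW (den_gt0 pv _)) //.
rewrite -invfM lef_pV2 ?posrE ?exprn_gt0 ?mulr_gt0 ?exprn_gt0 ?den_gt0 //.
have -> : den u 0 ^+ 2 * 4 = (2 * den u 0) ^+ 2 by ring.
rewrite lerXn2r ?nnegrE //.
- by rewrite ltW ?den_gt0.
- by rewrite mulr_ge0 // ltW ?den_gt0.
- exact: den_distortion.
Qed.

Lemma num0_le_den0 w : posw w -> num w 0 <= den w 0.
Proof.
case: w => [_|n w /= /andP[n0 pw]]; first by rewrite /num /= mul0r.
rewrite num_cons // -/(den (n :: w) 0) den_cons.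
have n1 : (1 : R) <= n%:R by rewrite ler1n.
have d0 := den_gt0 pw itv01_0; have p0 := num_ge0 pw itv01_0.
have : 1 * den w 0 <= n%:R * den w 0 by rewrite ler_pM2r.
by lra.
Qed.

(** Prepending a digit at least doubles the product: with q = [den] and p = [num] at 0, the new
    factors are at least q + p and 2q. *)
Lemma den_growth w : posw w -> 2 ^+ size w <= den w 0 * (den w 0 + num w 0).
Proof.
elim: w => [_|n w IH /= /andP[n0 pw]].
  by rewrite /num /= expr0 mul1r mul0r addr0.
rewrite num_cons // -/(den (n :: w) 0) den_cons.
have n1 : (1 : R) <= n%:R by rewrite ler1n.
have d0 := den_gt0 pw itv01_0; have p0 := num_ge0 pw itv01_0.
rewrite exprS.
have H : 1 * den w 0 <= n%:R * den w 0 by rewrite ler_pM2r.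
apply: (@le_trans _ _ ((den w 0 + num w 0) * (2 * den w 0))).
  by have := IH pw; lra.
by apply: ler_pM; lra.
Qed.

Lemma cyl_le_size w : posw w -> cyl w <= 2 / 2 ^+ size w.
Proof.
move=> pw; have d0 := den_gt0 pw itv01_0.
have H := den_growth pw; have P := num0_le_den0 pw.
have E : (0 : R) < 2 ^+ size w by rewrite exprn_gt0.
have -> : 2 / 2 ^+ size w = (2 ^+ size w / 2)^-1 :> R by rewrite invf_div.
rewrite lef_pV2 ?posrE ?divr_gt0 ?exprn_gt0 // ler_pdivrMr //.
apply: (le_trans H); rewrite expr2 -mulrA ler_pM2l //; lra.
Qed.

Lemma den_digit w n : posw w -> n \in w -> n%:R <= den w 0.
Proof.
elim: w => //= m w IH /andP[m0 pw].
have m1 : (1 : R) <= m%:R by rewrite ler1n.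
have d0 := den_ge1 pw itv01_0; have p0 := num_ge0 pw itv01_0.
have H : 1 * den w 0 <= m%:R * den w 0 by rewrite ler_wpM2r //; lra.
have H' : m%:R * 1 <= m%:R * den w 0 by rewrite ler_wpM2l //; lra.
rewrite -/(den (m :: w) 0) den_cons in_cons => /predU1P[->|/(IH pw)]; lra.
Qed.

(** Together with [cyl_le_size] this leaves only finitely many words whose cylinder exceeds a given
    size. *)
Lemma cyl_digit w n : posw w -> n \in w -> (n%:R : R) ^+ 2 * cyl w <= 1.
Proof.
move=> pw nw; have d0 := den_gt0 pw itv01_0.
rewrite ler_pdivrMr ?exprn_gt0 // mul1r lerXn2r ?nnegrE ?den_digit //.
exact: ltW.
Qed.

End Words.

(** * Values of continued fractions *)

#[local] Hint Resolve itv01_0 itv01_1 : core.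

Section ContinuedFractions.
Variable R : realType.
Implicit Types (b : nat -> nat) (w u v : seq nat) (x y : R).

Definition posd b := forall n, (0 < b n)%N.

Lemma posw_mkseq b k : posd b -> posw (mkseq b k).
Proof. by move=> pb; apply/allP => _ /mapP[i _ ->]. Qed.

Lemma mkseqSl b k : mkseq b k.+1 = b 0%N :: mkseq (fun n => b n.+1) k.
Proof. by rewrite /mkseq /= -[1%N]addn0 iotaDl -map_comp. Qed.

Lemma mkseqD b j k : mkseq b (j + k) = mkseq b j ++ mkseq (fun n => b (j + n)%N) k.
Proof.
by rewrite /mkseq iotaD map_cat add0n -[X in iota X k]addn0 iotaDl -map_comp.
Qed.

Lemma cf_truncE b k : cf_trunc R b k = moeb (mkseq b k) 0.
Proof. by elim: k b => // k IH b; rewrite mkseqSl /= IH. Qed.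

Lemma exists_pow2_gt x : exists n, x < 2 ^+ n.
Proof.
exists (Num.truncn `|x|).+1; apply: le_lt_trans (ler_norm x) _.
apply: lt_trans (truncnS_gt _) _.
by rewrite -natrX ltr_nat ltn_expl.
Qed.

Lemma exists_half_pow_lt x : 0 < x -> exists n, 2 / 2 ^+ n < x.
Proof.
move=> x0; have [n xn] := exists_pow2_gt (2 / x); exists n.
by rewrite ltr_pdivrMr ?exprn_gt0 // mulrC -ltr_pdivrMr.
Qed.

(** Both truncations are values of [moeb] along the common prefix of length [j]. *)
Lemma cf_trunc_dist b j k : posd b ->
  `|cf_trunc R b j - cf_trunc R b (j + k)| <= cyl R (mkseq b j).
Proof.
move=> pb; rewrite !cf_truncE mkseqD moeb_cat.
have pk : posw (mkseq (fun n => b (j + n)%N) k) by apply: posw_mkseq.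
have /andP[m0 m1] := moeb_itv pk (itv01_0 R).
apply: (le_trans (moeb_dist_le _ _ _)); rewrite ?posw_mkseq ?m0 ?m1 //.
rewrite sub0r normrN ger0_norm // -[leRHS]mulr1 ler_wpM2l //.
by rewrite ltW // cyl_gt0 // posw_mkseq.
Qed.

Lemma cf_trunc_cvg b : posd b -> cvgn (cf_trunc R b).
Proof.
move=> pb; apply/cauchy_cvgP/cauchy_exP => e e0.
have [n ne] := exists_half_pow_lt e0.
exists (cf_trunc R b n); exists n => // m /= nm; rewrite /ball /=.
rewrite -(subnKC nm); apply: le_lt_trans (cf_trunc_dist _ _ pb) _.
apply: le_lt_trans (cyl_le_size _ _) _; rewrite ?posw_mkseq ?size_mkseq //.
Qed.

Definition cfval b : R := limn (cf_trunc R b).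

Lemma cf_trunc_itv b k : posd b -> 0 <= cf_trunc R b k <= 1.
Proof. by move=> pb; rewrite cf_truncE moeb_itv // posw_mkseq. Qed.

Lemma cfval_itv b : posd b -> 0 <= cfval b <= 1.
Proof.
move=> pb; have c := cf_trunc_cvg pb; apply/andP; split.
  by apply: limr_ge => //; apply: nearW => n; have /andP[] := cf_trunc_itv n pb.
by apply: limr_le => //; apply: nearW => n; have /andP[] := cf_trunc_itv n pb.
Qed.

Lemma cfval_cons b : posd b ->
  cfval b = ((b 0%N)%:R + cfval (fun n => b n.+1))^-1.
Proof.
move=> pb; have pb' : posd (fun n => b n.+1) by move=> n.
have /andP[z0 z1] := cfval_itv pb'.
have n1 : (1 : R) <= (b 0%N)%:R by rewrite ler1n.
apply: cvg_lim => //; rewrite -cvg_shiftS /=.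
apply: cvgV; first by apply: lt0r_neq0; lra.
by apply: cvgD; [exact: cvg_cst | exact: cf_trunc_cvg].
Qed.

Lemma cfval_gt0 b : posd b -> 0 < cfval b.
Proof.
move=> pb; have pb' : posd (fun n => b n.+1) by move=> n.
have /andP[z0 z1] := cfval_itv pb'.
have n1 : (1 : R) <= (b 0%N)%:R by rewrite ler1n.
by rewrite cfval_cons // invr_gt0; lra.
Qed.

Lemma cfval_lt1 b : posd b -> cfval b < 1.
Proof.
move=> pb; have pb' : posd (fun n => b n.+1) by move=> n.
have z0 := cfval_gt0 pb'.
have n1 : (1 : R) <= (b 0%N)%:R by rewrite ler1n.
by rewrite cfval_cons // invf_lt1; lra.
Qed.

Lemma cfval_cat b k : posd b ->
  cfval b = moeb (mkseq b k) (cfval (fun n => b (k + n)%N)).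
Proof.
elim: k b => [|k IH] b pb; first by [].
have pb' : posd (fun n => b n.+1) by move=> n.
by rewrite cfval_cons // (IH _ pb') mkseqSl.
Qed.

(* Descent: a rational value p/q has a tail which is a rational value with
   denominator p < q. *)
Lemma cfval_neq_ratio b (p q : nat) : posd b -> cfval b != p%:R / q%:R.
Proof.
elim/ltn_ind: q p b => q IH p b pb; apply/negP => /eqP E.
have z0 := cfval_gt0 pb; have z1 := cfval_lt1 pb.
have pb' : posd (fun n => b n.+1) by move=> n.
have := cfval_cons pb; set y := cfval (fun n => b n.+1) => zy.
have y0 : 0 < y by exact: cfval_gt0.
have y1 : y < 1 by exact: cfval_lt1.
have n1 : (1 : R) <= (b 0%N)%:R by rewrite ler1n.
have q0 : (0 : R) < q%:R.
  by rewrite lt_neqAle ler0n andbT eq_sym; apply: contraTneq z0 => q0;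
     rewrite E q0 invr0 mulr0 ltxx.
have p0 : (0 : R) < p%:R by move: z0; rewrite E pmulr_lgt0 // invr_gt0.
have pq : (p < q)%N.
  by move: z1; rewrite E ltr_pdivrMr // mul1r ltr_nat.
have Ey : y = (q%:R - (b 0%N)%:R * p%:R) / p%:R.
  have : cfval b * ((b 0%N)%:R + y) = 1.
    by rewrite zy mulVf //; apply: lt0r_neq0; lra.
  rewrite E => H.
  have H2 : p%:R * ((b 0%N)%:R + y) = q%:R.
    by have := congr1 ( *%R q%:R) H; rewrite mulr1 => <-; field; apply: lt0r_neq0.
  by rewrite -H2; field; apply: lt0r_neq0.
have bpq : (b 0%N * p <= q)%N.
  rewrite -(ler_nat R) natrM -subr_ge0 ltW //.
  by move: y0; rewrite Ey pmulr_lgt0 // invr_gt0.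
have /negP := IH p pq (q - b 0%N * p)%N _ pb'; apply.
by rewrite -/y Ey natrB // natrM.
Qed.

Lemma cfval_irrational b : posd b -> irrational (cfval b).
Proof.
move=> pb; rewrite /irrational /= => /rationalP[a [q E]].
have z0 := cfval_gt0 pb.
case: a E => a; first by move/eqP; rewrite (negbTE (cfval_neq_ratio _ _ pb)).
rewrite NegzE mulrNz mulNr => E.
have : 0 <= a.+1%:R / q%:R :> R by rewrite divr_ge0.
rewrite -pmulrn in E; lra.
Qed.

(** Infinite expansions with positive digits have irrational values in the open unit interval, so
    the set is parametrised by digit sequences. *)
Lemma cf_setE (I : set nat) : I `<=` [set n | (0 < n)%N] ->
  cf_set R I = [set cfval b | b in [set b | forall n, I (b n)]].
Proof.
move=> I0; apply/seteqP; split=> z /=.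
  move=> [_ [_ [b [bI bz]]]]; exists b => //.
  exact: cvg_lim.
move=> [b bI <-]; have pb : posd b by move=> n; exact: I0.
split; first by rewrite cfval_gt0 // cfval_lt1.
split; first exact: cfval_irrational.
exists b; split => //; exact: cf_trunc_cvg.
Qed.

End ContinuedFractions.

(** * Hausdorff null sets *)

Section PowerFacts.
Variable R : realType.
Implicit Types (s t x y : R).

Lemma le_powRl s x y : 0 <= s -> 0 <= x -> x <= y -> x `^ s <= y `^ s.
Proof.
by move=> s0 x0 xy; apply: ge0_ler_powR; rewrite ?nnegrE // (le_trans x0 xy).
Qed.

Lemma lt_powRl s x y : 0 < s -> 0 <= x -> x < y -> x `^ s < y `^ s.
Proof.
by move=> s0 x0 xy; apply: gt0_ltr_powR; rewrite ?nnegrE // (le_trans x0 (ltW xy)).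
Qed.

Lemma le_powRr s t x : 0 < s -> 0 <= t <= s -> 0 <= x <= 1 -> x `^ s <= x `^ t.
Proof.
move=> s0 /andP[t0 ts] /andP[x0 x1]; move: x0; rewrite le_eqVlt => /predU1P[<-|x0].
  by rewrite powR0 ?powR_ge0 // gt_eqF.
by rewrite ger_powR // x0.
Qed.

Lemma powRV x t : 0 <= x -> x^-1 `^ t = (x `^ t)^-1.
Proof. by move=> x0; rewrite -powR_inv1 // -powRrM mulN1r powRN. Qed.

End PowerFacts.

Section HausdorffNull.
Variable R : realType.
Implicit Types (E : set R) (s t eta x y : R).

Lemma le_diam E x y : E x -> E y -> (`|x - y|%:E <= diam E)%E.
Proof. by move=> Ex Ey; apply: ereal_sup_ubound; exists (x, y). Qed.

Lemma diam_set0 : diam (set0 : set R) = -oo%E.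
Proof.
rewrite /diam (_ : [set _ | _ in _] = set0) ?ereal_sup0 //.
by apply/seteqP; split => // x [[a b] []].
Qed.

Lemma hausdorff_gauge_ge0 s E : (0 <= hausdorff_gauge s E)%E.
Proof. by rewrite /hausdorff_gauge; case: ifP => // _; exact: poweR_ge0. Qed.

(** Diameters at most 1 permit raising the exponent; the strict increase makes the new exponent
    positive even when [s] is 0. *)
Lemma hausdorff_gauge_dist s t E x y : 0 <= s -> s < t -> (diam E <= 1)%E ->
  E x -> E y -> ((`|x - y| `^ t)%:E <= hausdorff_gauge s E)%E.
Proof.
move=> s0 st d1 Ex Ey; rewrite /hausdorff_gauge ifF; last first.
  by apply/negP => /eqP E0; rewrite E0 in Ex.
have xyd := le_diam Ex Ey.
have : (diam E \is a fin_num)%E.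
  by rewrite fin_numElt (lt_le_trans _ xyd) ?ltNyr // (le_lt_trans d1) // ltry.
move: d1 xyd; case: (diam E) => // d; rewrite poweR_EFin !lee_fin => d1 xyd _.
apply: le_trans (@le_powRr _ t s d _ _ _).
- by rewrite le_powRl // (le_trans s0 (ltW st)).
- exact: le_lt_trans st.
- by rewrite s0 ltW.
- by rewrite d1 (le_trans _ xyd).
Qed.

(** A summable extra term makes every weight positive, so that no weight can stay below thresholds
    tending to 0. *)
Lemma hausdorff_null_cover E s t eta : 0 <= s -> s < t ->
  hausdorff_measure s E = 0%E -> 0 < eta ->
  exists (U : nat -> set R) (wt : nat -> R),
    [/\ forall i, 0 < wt i, E `<=` \bigcup_i U i,
        forall i x y, U i x -> U i y -> `|x - y| `^ t <= wt i &
        (\sum_(i <oo) (wt i)%:E < eta%:E)%E].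
Proof.
move=> s0 st HE eta0.
have eta2 : 0 < eta / 2 by rewrite divr_gt0.
have : (hausdorff_pre s 1 E < (eta / 2)%:E)%E.
  apply: (@le_lt_trans _ _ 0%E); last by rewrite lte_fin.
  rewrite -[leRHS]HE; apply: ereal_sup_ubound; exists 1; rewrite /= ?ltr01 //.
move=> /ereal_inf_lt[_ [U [Ud EU] <-] Ulim].
have gfin i : hausdorff_gauge s (U i) \is a fin_num.
  rewrite ge0_fin_numE ?hausdorff_gauge_ge0 //.
  apply: le_lt_trans (lt_trans Ulim (ltry _)).
  apply: le_trans (nneseries_lim_ge i.+1 (fun i _ _ => hausdorff_gauge_ge0 _ _)).
  by rewrite big_nat_recr //= leeDr // sume_ge0 // => j _; exact: hausdorff_gauge_ge0.
exists U, (fun i => fine (hausdorff_gauge s (U i)) + eta / 2 / (2 ^ i.+1)%:R).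
split => //.
- move=> i; rewrite ltr_wpDl ?divr_gt0 ?ltr0n ?expn_gt0 //.
  by rewrite fine_ge0 // hausdorff_gauge_ge0.
- move=> i x y Ux Uy.
  have := hausdorff_gauge_dist s0 st (Ud i) Ux Uy.
  rewrite -{1}(fineK (gfin i)) lee_fin => /le_trans; apply.
  by rewrite lerDl divr_ge0 // ltW.
- under eq_eseriesr do rewrite EFinD fineK //.
  apply: le_lt_trans (epsilon_trick _ _ _) _.
  + by move=> i; exact: hausdorff_gauge_ge0.
  + exact: ltW.
  + by rewrite [eta in ltRHS]splitr EFinD lteD2rE.
Qed.

End HausdorffNull.

(** * Words over a finite alphabet *)

Section WordEnumeration.

Fixpoint words (ds : seq nat) k : seq (seq nat) :=
  if k is j.+1 then [seq n :: w | n <- ds, w <- words ds j] else [:: [::]].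

Lemma mem_words ds k w : (w \in words ds k) = (size w == k) && all (mem ds) w.
Proof.
elim: k w => [|k IH] [|n w] //=.
- by apply/negP => /allpairsP[[? ?] /= [_ _]].
- apply/allpairsP/idP => [[[m v] /= [mds vds [-> ->]]]|].
    by move: vds; rewrite IH => /andP[/eqP -> ->]; rewrite eqxx mds.
  rewrite eqSS => /and3P[sw nds wds]; exists (n, w); split => //=.
  by rewrite IH sw.
Qed.

Lemma words_uniq ds k : uniq ds -> uniq (words ds k).
Proof.
move=> uds; elim: k => //= k IH; apply: allpairs_uniq => //.
by move=> [n w] [m v] _ _ /= [-> ->].
Qed.

Lemma all_words_pos ds k w : all (fun n => 0 < n)%N ds -> w \in words ds k ->
  posw w.
Proof.
move=> /allP ds0; rewrite mem_words => /andP[_ /allP wds].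
by apply/allP => n /wds /ds0.
Qed.

End WordEnumeration.

(** * Boundedness of the level sums *)

Section Separation.
Variable R : realType.
Implicit Types (w u v a : seq nat) (t x y z : R).

Definition digit_le t (n : nat) := (0 < n)%N && (n%:R + 1 <= t).

(* [core t] is invariant under x |-> 1/(n+x) for digits n <= t - 1, and stays
   away from both ends of the unit interval, which separates the cylinders. *)
Definition core t : set R := [set y | t^-1 <= y <= 1 - t^-1 / 2].

Lemma digit_leP t n : digit_le t n -> 1 <= n%:R :> R /\ n%:R + 1 <= t.
Proof. by move=> /andP[n0 nt]; rewrite ler1n. Qed.

Lemma core_itv t y : 0 < t -> core t y -> 0 <= y <= 1.
Proof. by rewrite -invr_gt0 => t0 /andP[y0 y1]; lra. Qed.

(** The argument may be as large as 1: one inverse branch already moves it away from 1 by the amount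
    required in [core]. *)
Lemma core_step t n y : digit_le t n -> t^-1 <= y <= 1 -> core t (n%:R + y)^-1.
Proof.
move=> /digit_leP[n1 nt] /andP[y0 y1]; rewrite /core /=.
have i0 : 0 < t^-1 by rewrite invr_gt0; lra.
apply/andP; split; first by rewrite lef_pV2 ?posrE; lra.
apply: (@le_trans _ _ (1 + t^-1)^-1); first by rewrite lef_pV2 ?posrE; lra.
rewrite -subr_ge0 (_ : _ - _ = (t - 1) / (2 * t * (t + 1))).
  by rewrite divr_ge0 ?mulr_ge0; lra.
by field; repeat (apply/andP; split); lra.
Qed.

Lemma core_moeb t u y : 0 < t -> all (digit_le t) u -> core t y ->
  core t (moeb u y).
Proof.
move=> t0 + yX; elim: u => //= n u IH /andP[nds uds].
apply: core_step; first exact: nds.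
have uX := IH uds; have /andP[_ ->] := core_itv t0 uX.
by case/andP: uX => ->.
Qed.

(** For n < m the numerator of the difference is at least 1 + y' - y, which on [core] exceeds
    1/(2t); both denominators are at most t. *)
Lemma core_sep1 t n m y y' : digit_le t n -> digit_le t m ->
  core t y -> core t y' -> n != m ->
  t^-1 / 2 / t ^+ 2 <= `|(n%:R + y)^-1 - (m%:R + y')^-1|.
Proof.
wlog nm : n m y y' / (n < m)%N.
  move=> H nX mX yX yX'; rewrite neq_ltn => /orP[nm|mn].
    by apply: H => //; rewrite neq_ltn nm.
  by rewrite distrC; apply: H => //; rewrite neq_ltn mn.
move=> /digit_leP[n1 nt] /digit_leP[m1 mt] yX yX' _.
have t0 : 0 < t by lra.
have /andP[y0 y1] := core_itv t0 yX; have /andP[y0' y1'] := core_itv t0 yX'.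
move: yX yX' => /andP[ya yb] /andP[ya' yb'].
have mn1 : n%:R + 1 <= m%:R :> R by rewrite natr1 ler_nat.
have E : (n%:R + y)^-1 - (m%:R + y')^-1 =
    (m%:R - n%:R + y' - y) / ((n%:R + y) * (m%:R + y')).
  by field; apply/andP; split; lra.
have i0 : 0 < t^-1 by rewrite invr_gt0.
rewrite E ger0_norm; last by rewrite divr_ge0 ?mulr_ge0; lra.
apply: ler_pM.
- by lra.
- by rewrite invr_ge0 exprn_ge0 // ltW.
- by lra.
- rewrite lef_pV2 ?posrE ?exprn_gt0 ?mulr_gt0 //; try lra.
  by rewrite expr2; apply: ler_pM; lra.
Qed.

(** Words with different first digits are separated by [core_sep1]; a common first digit shrinks the
    distance by a factor of at most t^2. *)
Lemma words_separated t ds k : 0 < t -> all (digit_le t) ds ->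
  exists2 delta : R, 0 < delta & forall a b y y',
    a \in words ds k -> b \in words ds k -> a != b -> core t y -> core t y' ->
    delta <= `|moeb a y - moeb b y'|.
Proof.
move=> t0 /allP dsX; elim: k => [|k [d d0 IH]].
  by exists 1 => // a b y y'; rewrite !inE => /eqP -> /eqP ->; rewrite eqxx.
exists (Num.min (d / t ^+ 2) (t^-1 / 2 / t ^+ 2)).
  by rewrite lt_min !divr_gt0 ?invr_gt0 ?exprn_gt0.
move=> a b y y'; rewrite !mem_words.
case: a => [|n a] //; case: b => [|m b] //=.
rewrite !eqSS => /and3P[sa nds ads] /and3P[sb mds bds] ab yX yX'.
have sub (c : seq nat) : all (mem ds) c -> all (digit_le t) c.
  by apply: sub_all => i; exact: dsX.
have ca := core_moeb t0 (sub _ ads) yX; have cb := core_moeb t0 (sub _ bds) yX'.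
rewrite ge_min; apply/orP; have [nm|nm] := eqVneq n m; last first.
  by right; apply: core_sep1 => //; apply: dsX.
subst m; left.
have ab' : a != b by apply: contra ab => /eqP ->.
have := IH a b y y'; rewrite !mem_words sa sb => /(_ ads bds ab' yX yX').
have /andP[x0 x1] := core_itv t0 ca; have /andP[z0 z1] := core_itv t0 cb.
set x := moeb a y in x0 x1 *; set z := moeb b y' in z0 z1 *.
have /digit_leP[n1 nt] := dsX n nds.
have -> : (n%:R + x)^-1 - (n%:R + z)^-1 = (z - x) / ((n%:R + x) * (n%:R + z)).
  by field; apply/andP; split; lra.
move=> dxz; rewrite normrM distrC; apply: ler_pM => //.
- exact: ltW.
- by rewrite invr_ge0 exprn_ge0 // ltW.
rewrite ger0_norm ?invr_ge0 ?mulr_ge0 //; try lra.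
rewrite lef_pV2 ?posrE ?exprn_gt0 ?mulr_gt0 //; try lra.
by rewrite expr2; apply: ler_pM; lra.
Qed.

(** Two digits are used: the second bounds the tail below by 1/t, and the first then carries it into
    [core]. *)
Lemma core_cfval t b : (forall n, digit_le t (b n)) -> core t (cfval R b).
Proof.
move=> bX; have pb : posd b by move=> n; have /andP[] := bX n.
have pb' : posd (fun n => b n.+1) by move=> n.
rewrite cfval_cons //; apply: core_step; first exact: bX.
have /andP[y0 ->] := cfval_itv R pb'; rewrite andbT cfval_cons //.
have /andP[z0 z1] := cfval_itv R (fun n => pb' n.+1).
set z := cfval _ _ in z0 z1 *.
have /digit_leP[n1 nt] := bX 1%N.
by rewrite lef_pV2 ?posrE; lra.
Qed.

Lemma digits_bounded (ds : seq nat) : all (fun n => 0 < n)%N ds ->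
  exists2 t : R, 0 < t & all (digit_le t) ds.
Proof.
elim: ds => [|n ds IH] /=; first by exists 1.
move=> /andP[n0 /IH[t t0 dst]]; exists (t + n%:R + 1).
  by rewrite ltr_wpDl // addr_ge0 // ltW.
apply/andP; split.
  by rewrite /digit_le n0 lerD2r lerDr ltW.
apply: sub_all dst => m /andP[m0 mt]; rewrite /digit_le m0 /=.
by apply: le_trans mt _; rewrite -addrA lerDl addr_ge0.
Qed.

End Separation.


Lemma sum_indic (R : numDomainType) (T : Type) (s : seq T) (P : pred T) :
  \sum_(a <- s) (P a)%:R = (count P s)%:R :> R.
Proof.
by elim: s => [|a s IH]; rewrite ?big_nil // big_cons IH /= natrD.
Qed.

Lemma count_le1 (T : eqType) (s : seq T) (P : pred T) :
  uniq s -> {in s &, forall a b, P a -> P b -> a = b} -> (count P s <= 1)%N.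
Proof.
move=> us h; rewrite -size_filter; have := filter_uniq P us.
have : {in [seq x <- s | P x] &, forall a b, a = b}.
  by move=> a b; rewrite !mem_filter => /andP[Pa sa] /andP[Pb sb]; exact: h.
case: [seq x <- s | P x] => [|a [|b l]] //= h' /andP[].
by rewrite (h' a b) ?inE ?eqxx // orbT.
Qed.

Section Pressure.
Variables (R : realType) (t s delta : R) (ds : seq nat) (k : nat).
Variables (U : nat -> set R) (wt : nat -> R).
Hypotheses (t0 : 0 < t) (s0 : 0 < s) (delta0 : 0 < delta).
Hypotheses (uds : uniq ds) (dst : all (digit_le t) ds).
Hypothesis wt0 : forall i, 0 < wt i.
Hypothesis Uwt : forall i x y, U i x -> U i y -> `|x - y| `^ s <= wt i.
Hypothesis sep : forall a b y y', a \in words ds k -> b \in words ds k ->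
  a != b -> core t y -> core t y' -> delta <= `|moeb a y - moeb b y'|.

(** Only the part of the cylinder over [core t] counts, because the separation hypothesis is
    confined to it. *)
Definition hits (u : seq nat) i := `[< exists2 y, core t y & U i (moeb u y) >].

Definition mass (u : seq nat) : \bar R :=
  (\sum_(i <oo) (wt i * (hits u i)%:R)%:E)%E.

Lemma mass_term_ge0 u i : (0 <= (wt i * (hits u i)%:R)%:E)%E.
Proof. by rewrite lee_fin mulr_ge0 // ltW. Qed.

Lemma mass_ge u i : hits u i -> ((wt i)%:E <= mass u)%E.
Proof.
move=> ui; apply: le_trans (nneseries_lim_ge i.+1 (fun i _ _ => mass_term_ge0 u i)).
rewrite big_nat_recr //= ui mulr1 leeDr // sume_ge0 // => j _.
exact: mass_term_ge0.
Qed.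

Lemma ds_pos u : all (mem ds) u -> posw u.
Proof.
move=> /allP uds'; apply/allP => n /uds' nds.
by have := allP dst _ nds => /andP[].
Qed.

Lemma ds_le u : all (mem ds) u -> all (digit_le t) u.
Proof. by move=> /allP uds'; apply/allP => n /uds' nds; exact: (allP dst). Qed.

(** A covering set too light for the threshold of [u] cannot hit two different extensions, so the
    masses of the extensions add up to at most [mass u]. Their thresholds add up to at least that of
    [u], by [cyl_cat_ge] and the assumption on the sum; hence one extension is light again. *)
Lemma mass_step u : all (mem ds) u ->
  1 <= \sum_(a <- words ds k) (cyl R a / 4) `^ s ->
  (mass u < ((cyl R u / 4 * delta) `^ s)%:E)%E ->
  exists2 a, a \in words ds k &
    (mass (u ++ a) < ((cyl R (u ++ a) / 4 * delta) `^ s)%:E)%E.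
Proof.
move=> udsu sum1 massu; have pu := ds_pos udsu.
have cu := cyl_gt0 R pu.
apply: contrapT => no.
have {}no a : a \in words ds k ->
    (((cyl R u / 4 * delta) `^ s * (cyl R a / 4) `^ s)%:E <= mass (u ++ a))%E.
  move=> aw; have pa : posw a.
    by apply: ds_pos; move: aw; rewrite mem_words => /andP[].
  have ca := cyl_gt0 R pa.
  have : ~~ (mass (u ++ a) < ((cyl R (u ++ a) / 4 * delta) `^ s)%:E)%E.
    by apply/negP => h; apply: no; exists a.
  rewrite -leNgt; apply: le_trans; rewrite lee_fin -powRM; last 2 first.
  - by rewrite !mulr_ge0 // ltW.
  - by rewrite !mulr_ge0 // ltW.
  rewrite le_powRl ?(ltW s0) //; first by rewrite !mulr_ge0 // ltW.
  have -> : cyl R u / 4 * delta * (cyl R a / 4) = cyl R u * cyl R a / 4 / 4 * delta.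
    by field.
  by rewrite !ler_wpM2r ?cyl_cat_ge // ltW.
have ge : (((cyl R u / 4 * delta) `^ s)%:E
    <= \sum_(a <- words ds k) mass (u ++ a))%E.
  apply: (@le_trans _ _ (\sum_(a <- words ds k)
      ((cyl R u / 4 * delta) `^ s * (cyl R a / 4) `^ s)%:E)%E).
    rewrite sumEFin lee_fin -big_distrr /= -[leLHS]mulr1 ler_wpM2l //.
    exact: powR_ge0.
  by rewrite big_seq [leRHS]big_seq; apply: lee_sum => a; exact: no.
have le : (\sum_(a <- words ds k) mass (u ++ a) <= mass u)%E.
  rewrite /mass -nneseries_sum; last by move=> a i _; exact: mass_term_ge0.
  apply: lee_nneseries => [i _ _|i _].
    by apply: sume_ge0 => a _; exact: mass_term_ge0.
  rewrite sumEFin lee_fin -big_distrr /= sum_indic ler_wpM2l ?(ltW (wt0 i)) //.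
  rewrite ler_nat.
  have sub a : a \in words ds k -> hits (u ++ a) i -> hits u i.
    rewrite mem_words => /andP[_ ads] /asboolP[y ty Uy]; apply/asboolP.
    by exists (moeb a y); [exact: core_moeb (ds_le ads) _ | rewrite -moeb_cat].
  have [ui|nui] := boolP (hits u i); last first.
    rewrite /= leqn0 eqn0Ngt -has_count; apply/hasPn => a aw.
    by apply: contra nui; exact: sub.
  apply: count_le1; first exact: words_uniq.
  move=> a b aw bw /asboolP[y ty Uy] /asboolP[y' ty' Uy'].
  apply/eqP; apply: contraT => ab.
  have dd := sep aw bw ab ty ty'.
  (* A set hitting both extensions would weigh at least the threshold of [u], while its weight is at
     most [mass u]. *)
  have := le_lt_trans (mass_ge ui) massu; rewrite lte_fin ltNge => /negP; case.
  apply: le_trans (Uwt Uy Uy'); rewrite le_powRl ?(ltW s0) //.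
    by rewrite !mulr_ge0 // ltW.
  have aux c z : c \in words ds k -> core t z -> 0 <= moeb c z <= 1.
    rewrite mem_words => /andP[_ cds] tz; apply: moeb_itv (ds_pos cds) _.
    exact: core_itv tz.
  rewrite !moeb_cat; apply: le_trans (moeb_dist_ge _ _ _) => //.
  - by rewrite ler_wpM2l // ltW // divr_gt0.
  - exact: aux.
  - exact: aux.
by have := lt_le_trans massu (le_trans ge le); rewrite ltxx.
Qed.

End Pressure.

Section PressureBound.
Variable R : realType.

(** Nested words are glued: digit m is read off [u m.+1], whose length k (m + 1) exceeds m, and all
    longer words extend it. *)
Lemma mkseq_chain (u : nat -> seq nat) (k : nat) (b : nat -> nat) : (0 < k)%N ->
  u 0%N = [::] -> (forall n, size (u n) = (k * n)%N) ->
  (forall n, exists a, u n.+1 = u n ++ a) ->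
  (forall m, b m = nth 0%N (u m.+1) m) ->
  forall n, mkseq b (k * n) = u n.
Proof.
move=> k0 u0 su us bE n; apply: (@eq_from_nth _ 0%N).
  by rewrite size_mkseq su.
move=> i; rewrite size_mkseq => ikn; rewrite nth_mkseq // bE.
have pre p q : exists a, u (p + q)%N = u p ++ a.
  elim: q => [|q [a IH]]; first by exists [::]; rewrite addn0 cats0.
  have [a' E] := us (p + q)%N; exists (a ++ a'); by rewrite addnS E IH catA.
have i1 : (i < size (u i.+1))%N by rewrite su (leq_trans _ (leq_pmull _ k0)).
have i2 : (i < size (u n))%N by rewrite su.
have [le|/ltnW le] := leqP i.+1 n.
  by have [a] := pre i.+1 (n - i.+1)%N; rewrite subnKC // => ->; rewrite nth_cat i1.
by have [a] := pre n (i.+1 - n)%N; rewrite subnKC // => ->; rewrite nth_cat i2.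
Qed.

(* Otherwise an infinite word can be chosen digit block by digit block along
   which the sets of a cheap cover stay too light; its value lies in none. *)
Lemma pressure_lt1 (I : set nat) (s s' : R) (ds : seq nat) k :
  I `<=` [set n | (0 < n)%N] -> 0 <= s' -> s' < s ->
  hausdorff_measure s' (cf_set R I) = 0%E ->
  uniq ds -> {in ds, forall n, I n} ->
  \sum_(w <- words ds k) (cyl R w / 4) `^ s < 1.
Proof.
move=> I0 s'0 s's null uds dsI; rewrite ltNge; apply/negP => sum1.
have s0 : 0 < s by exact: le_lt_trans s's.
have pds : all (fun n => 0 < n)%N ds by apply/allP => n /dsI /I0.
have [t t0 dst] := digits_bounded R pds.
have [delta delta0 sep] := words_separated k t0 dst.
(* For k = 0 the sum is 4^-s, already below 1. *)
have k0 : (0 < k)%N.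
  rewrite lt0n; apply/negP => /eqP k0; move: sum1; rewrite k0 /= big_seq1.
  rewrite leNgt => /negP; apply; rewrite cyl_nil mul1r.
  by have := @lt_powRl _ s 4^-1 1 s0; rewrite powR1; apply; lra.
(* The threshold of [mass_step] for the empty word. *)
pose eta := (cyl R [::] / 4 * delta) `^ s.
have eta0 : 0 < eta by rewrite powR_gt0 // cyl_nil mulr_gt0 //; lra.
have [U [wt [wt0 cov Uwt sumwt]]] := hausdorff_null_cover s'0 s's null eta0.
pose good u := all (mem ds) u /\
  (mass t U wt u < ((cyl R u / 4 * delta) `^ s)%:E)%E.
have good0 : good [::].
  split => //; apply: le_lt_trans sumwt; apply: lee_nneseries => i _ //.
    by rewrite lee_fin mulr_ge0 // ltW.
  by rewrite lee_fin -[leRHS]mulr1 ler_wpM2l ?(ltW (wt0 i)) // lern1 leq_b1.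
have step (u : {u | good u}) : {v : {v | good v} |
    exists2 a, a \in words ds k & sval v = sval u ++ a}.
  apply: cid; case: u => u [gu1 gu2] /=.
  have [a aw ga] := mass_step t0 s0 delta0 uds dst wt0 Uwt sep gu1 sum1 gu2.
  have gv : good (u ++ a).
    split => //; rewrite all_cat gu1 /=.
    by move: aw; rewrite mem_words => /andP[].
  by exists (exist _ _ gv); exists a.
pose v := nat_rect (fun _ => {u | good u}) (exist _ _ good0) (fun _ u => sval (step u)).
pose u n := sval (v n).
have us n : exists2 a, a \in words ds k & u n.+1 = u n ++ a.
  exact: svalP (step (v n)).
have su n : size (u n) = (k * n)%N.
  elim: n => [|n IH]; first by rewrite muln0.
  have [a aw ->] := us n; rewrite size_cat IH mulnS addnC.
  by move: aw; rewrite mem_words => /andP[/eqP ->].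
pose b m := nth 0%N (u m.+1) m.
have bu := @mkseq_chain u k b k0 erefl su
  (fun n => let: ex_intro2 a _ e := us n in ex_intro _ a e) (fun=> erefl).
have bds m : b m \in ds.
  have [/allP gm _] := svalP (v m.+1); apply: gm; apply: mem_nth.
  by rewrite -/(u _) su (leq_trans _ (leq_pmull _ k0)).
have bt m : digit_le t (b m) by exact: (allP dst).
have pb : posd b by move=> m; have /andP[] := bt m.
have zF : cf_set R I (cfval R b).
  by rewrite cf_setE //; exists b => // n; apply: dsI.
have [i _ Uz] := cov _ zF.
(* The tails of the expansion lie in [core t], so the set [U i] containing the value hits every
   prefix. Its fixed positive weight is then below thresholds that tend to 0. *)
have wsmall n : wt i < (cyl R (u n) / 4 * delta) `^ s.
  have [_ gm] := svalP (v n); rewrite -lte_fin; apply: le_lt_trans gm.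
  apply: mass_ge => //; apply/asboolP.
  exists (cfval R (fun m => b (k * n + m)%N)); first exact: core_cfval.
  by rewrite -/(u n) -bu -cfval_cat.
have [n nsmall] := exists_half_pow_lt (divr_gt0 (powR_gt0 s^-1 (wt0 i)) delta0).
have := wsmall n; rewrite ltNge => /negP; apply.
have -> : wt i = (wt i `^ s^-1) `^ s.
  by rewrite -powRrM mulVf ?powRr1 ?(ltW (wt0 i)) // gt_eqF.
have pu : posw (u n) by rewrite -bu posw_mkseq.
have cu := cyl_gt0 R pu.
rewrite le_powRl ?(ltW s0) //; first by rewrite !mulr_ge0 // ltW.
rewrite -ler_pdivlMr //; apply: le_trans (ltW nsmall).
apply: (@le_trans _ _ (cyl R (u n))); first by lra.
apply: le_trans (cyl_le_size R pu) _; rewrite ler_pM2l //.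
rewrite lef_pV2 ?posrE ?exprn_gt0 // ler_weXn2l ?ler1n //.
by rewrite su leq_pmull.
Qed.

End PressureBound.

(** * Covering numbers *)

Section Coverings.
Variable R : realType.
Implicit Types (A B : set R) (rho m c x y : R).

(* Sets of small diameter instead of balls: such covers pull back and push
   forward along Lipschitz maps without recentring. *)
Definition dcov rho m A := exists (n : nat) (U : nat -> set R),
  [/\ n%:R <= m, forall x, A x -> exists2 i, (i < n)%N & U i x &
      forall i x y, U i x -> U i y -> `|x - y| < rho].

Lemma dcov_sub rho m m' A B : A `<=` B -> m <= m' -> dcov rho m B -> dcov rho m' A.
Proof.
move=> AB mm' [n [U [nm BU Ur]]]; exists n, U; split => //.
- exact: le_trans mm'.
- by move=> x /AB /BU.
Qed.

Lemma dcov0 rho : dcov rho 0 set0.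
Proof. by exists 0%N, (fun=> set0); split. Qed.

Lemma dcovU rho m m' A B : dcov rho m A -> dcov rho m' B ->
  dcov rho (m + m') (A `|` B).
Proof.
move=> [n [U [nm AU Ur]]] [n' [U' [nm' BU Ur']]].
exists (n + n')%N, (fun i => if (i < n)%N then U i else U' (i - n)%N); split.
- by rewrite natrD lerD.
- move=> x [/AU[i ii Ui]|/BU[i ii Ui]].
    by exists i; rewrite ?ii // (leq_trans ii) // leq_addr.
  by exists (n + i)%N; rewrite ?ltn_add2l // ltnNge leq_addr /= addKn.
- by move=> i x y; case: ifP => _; [exact: Ur | exact: Ur'].
Qed.

Lemma dcov_seq rho (T : eqType) (s : seq T) (f : T -> R) (A : T -> set R) :
  {in s, forall i, dcov rho (f i) (A i)} ->
  dcov rho (\sum_(i <- s) f i) [set x | exists2 i, i \in s & A i x].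
Proof.
elim: s => [|i s IH] H.
  by rewrite big_nil; apply: dcov_sub (dcov0 rho) => // x [].
rewrite big_cons; apply: dcov_sub (lexx _) (dcovU (H i _) (IH _)).
- move=> x [j]; rewrite in_cons => /predU1P[->|js] Aj; first by left.
  by right; exists j.
- by rewrite inE eqxx.
- by move=> j js; apply: H; rewrite inE js orbT.
Qed.

Lemma dcov_itv rho a L A : 0 < rho -> (forall x, A x -> a <= x <= a + L) ->
  0 <= L -> dcov rho (2 * L / rho + 1) A.
Proof.
move=> r0 AL L0.
have r20 : 0 < rho / 2 by rewrite divr_gt0.
exists (Num.truncn (2 * L / rho)).+1,
  (fun i => [set x | a + i%:R * (rho / 2) <= x < a + i.+1%:R * (rho / 2)]).
split.
- rewrite -natr1 lerD2r truncn_le // divr_ge0 ?mulr_ge0 //; exact: ltW.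
- move=> x /AL /andP[ax xL]; exists (Num.truncn ((x - a) / (rho / 2))).
    rewrite ltnS le_truncn // (_ : 2 * L / rho = L / (rho / 2)).
      by rewrite ler_wpM2r ?invr_ge0 ?(ltW r20) // lerBlDl.
    by field; rewrite gt_eqF.
  have xa : 0 <= (x - a) / (rho / 2).
    by rewrite divr_ge0 ?(ltW r20) // subr_ge0.
  have /andP[t1 t2] := truncn_itv xa.
  rewrite ler_pdivlMr // in t1; rewrite ltr_pdivrMr // in t2.
  by rewrite /=; lra.
- move=> i x y /= /andP[x1 x2] /andP[y1 y2].
  rewrite -natr1 mulrDl mul1r in x2 y2.
  by rewrite ltr_norml; lra.
Qed.

Lemma dcov_diam rho L A : 0 < rho ->
  (forall x y, A x -> A y -> `|x - y| <= L) -> 0 <= L ->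
  dcov rho (4 * L / rho + 1) A.
Proof.
move=> r0 AL L0; have [[x0 Ax0]|nA] := pselect (exists x, A x); last first.
  apply: dcov_sub (dcov0 rho).
    by move=> x Ax; exfalso; apply: nA; exists x.
  by rewrite addr_ge0 // divr_ge0 ?mulr_ge0 // ltW.
apply: dcov_sub (@dcov_itv rho (x0 - L) (2 * L) A r0 _ _) => //.
- by rewrite mulrA -natrM.
- by move=> x Ax; have := AL _ _ Ax Ax0; rewrite ler_norml; lra.
- by rewrite mulr_ge0.
Qed.

Lemma dcov_image rho m c (f : R -> R) A : 0 < c ->
  (forall x y, A x -> A y -> `|f x - f y| <= c * `|x - y|) ->
  dcov rho m A -> dcov (c * rho) m (f @` A).
Proof.
move=> c0 fc [n [U [nm AU Ur]]]; exists n, (fun i => f @` (U i `&` A)); split => //.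
- by move=> _ [x Ax <-]; have [i ii Ui] := AU _ Ax; exists i => //; exists x.
- move=> i _ _ [x [Ux Ax] <-] [y [Uy Ay] <-].
  by apply: le_lt_trans (fc _ _ Ax Ay) _; rewrite ltr_pM2l // (Ur i).
Qed.

Lemma dcov_preimage rho m c (f : R -> R) A : 0 < c ->
  (forall x y, A x -> A y -> c * `|x - y| <= `|f x - f y|) ->
  dcov rho m (f @` A) -> dcov (rho / c) m A.
Proof.
move=> c0 fc [n [U [nm AU Ur]]].
exists n, (fun i => A `&` f @^-1` (U i)); split => //.
- by move=> x Ax; have [i ii Ui] := AU (f x) (ex_intro2 _ _ x Ax erefl); exists i.
- move=> i x y [Ax Ux] [Ay Uy]; rewrite ltr_pdivlMr // mulrC.
  by apply: le_lt_trans (fc _ _ Ax Ay) _; apply: (Ur i).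
Qed.

Lemma covering_number_le rho m A : dcov rho m A -> (covering_number rho A <= m%:E)%E.
Proof.
move=> [n [U [nm AU Ur]]].
apply: (@le_trans _ _ n%:R%:E); last by rewrite lee_fin.
apply: ereal_inf_lbound; exists n => //=.
(* The default 0 is taken only at empty sets, which cover no point. *)
exists (fun i => xget 0 (U i)) => x Ax.
have [i ii Ui] := AU _ Ax; exists i => //.
rewrite /ball /=; apply: Ur; last exact: Ui.
exact: xgetPex (ex_intro _ x Ui).
Qed.

(** An infimum over natural numbers is attained as soon as it is finite, and two points of a ball
    are less than twice its radius apart. *)
Lemma dcov_covering_number rho m A :
  (covering_number rho A <= m%:E)%E -> dcov (2 * rho) m A.
Proof.
rewrite /covering_number.
set P := [set n : nat | _]; move=> infm.
have [[n Pn]|nP] := pselect (exists n, P n); last first.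
  move: infm; rewrite (_ : [set _ | _ in _] = set0) ?ereal_inf0 //.
  by apply/seteqP; split => // x [k Pk _]; exfalso; apply: nP; exists k.
have [k /asboolP Pk kmin] := @ex_minnP (fun n => `[< P n >]) (ex_intro _ n (asboolT Pn)).
have km : k%:R <= m.
  rewrite -lee_fin; apply: le_trans infm; apply: le_ereal_inf_tmp => _ [j Pj <-].
  by rewrite lee_fin ler_nat; apply: kmin; apply/asboolP.
have [c Ac] := Pk; exists k, (fun i => ball (c i) rho); split => //.
move=> i x y; rewrite /ball /= => cx cy.
rewrite (_ : x - y = (c i - y) - (c i - x)); last by ring.
by apply: le_lt_trans (ler_normB _ _) _; rewrite mulr_natl mulr2n ltrD.
Qed.

End Coverings.

(** * Density of the digit set and sums over all words *)

Section Alphabet.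
Variable R : realType.
Implicit Types (I : set nat) (s e x : R).

Definition alph I (X : nat) : seq nat := [seq n <- iota 1 X | n \in I].

Lemma alph_uniq I X : uniq (alph I X).
Proof. by rewrite seq.filter_uniq // iota_uniq. Qed.

Lemma mem_alph I X n : (n \in alph I X) = (n \in I) && (0 < n <= X)%N.
Proof. by rewrite mem_filter mem_iota add1n ltnS. Qed.

Lemma alph_pos I X : all (fun n => 0 < n)%N (alph I X).
Proof. by apply/allP => n; rewrite mem_alph => /and3P[]. Qed.

Lemma alph_sub I X : {in alph I X, forall n, I n}.
Proof. by move=> n; rewrite mem_alph => /andP[/set_mem]. Qed.

Lemma count_uptoE I N : count_upto I N = size (alph I N).
Proof.
rewrite /count_upto cardfE -cardfE; apply: perm_size; apply: uniq_perm.
- exact: fset_uniq.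
- exact: alph_uniq.
move=> n; have fin : finite_set (I `&` [set k | (1 <= k <= N)%N]).
  apply: sub_finite_set (finite_II N.+1) => k [_ /= /andP[_]].
  by rewrite ltnS.
by rewrite in_fset_set // in_setI mem_alph; congr (_ && _); apply/idP/idP;
   rewrite inE.
Qed.

(** If the count stayed below N^(1-e) from some rank on, the limit superior would be at most 1 -
    e. *)
Lemma density_frequently I e (N0 : nat) : 0 < e < 1 ->
  limn_esup (fun N : nat => (ln (count_upto I N)%:R / ln N%:R : R)%:E) = 1%E ->
  exists2 N : nat, (N0 <= N)%N & N%:R `^ (1 - e) <= (size (alph I N))%:R.
Proof.
move=> /andP[e0 e1] lim1; apply: contrapT => no.
have {}no N : (N0 <= N)%N -> (size (alph I N))%:R < N%:R `^ (1 - e).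
  by move=> NN; rewrite ltNge; apply/negP => h; apply: no; exists N.
suff : (limn_esup (fun N : nat => (ln (count_upto I N)%:R / ln N%:R : R)%:E)
   <= (1 - e)%:E)%E by rewrite lim1 lee_fin; lra.
apply: ge_ereal_inf; exists (ereal_sup
  [set (ln (count_upto I N)%:R / ln N%:R : R)%:E | N in [set N | (maxn 2 N0 <= N)%N]]).
  by exists [set N | (maxn 2 N0 <= N)%N] => //; exists (maxn 2 N0).
apply: ge_ereal_sup => _ [N /= + <-]; rewrite geq_max => /andP[N2 NN].
rewrite lee_fin count_uptoE.
have N1 : 1 < N%:R :> R by rewrite ltr1n.
have lnN : 0 < ln N%:R :> R by rewrite ln_gt0.
rewrite ler_pdivrMr //.
(* For an empty count the quotient is 0, because [ln] is 0 at 0. *)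
have [->|s0] := posnP (size (alph I N)).
  by rewrite ln0 // mulr_ge0 ?(ltW lnN) // subr_ge0 ltW.
rewrite -ln_powR ler_ln ?posrE ?ltr0n //; first exact: ltW (no N NN).
by rewrite powR_gt0 // (lt_trans ltr01).
Qed.

Lemma exists_large_powR x e : 0 < e ->
  exists N0 : nat, forall N, (N0 <= N)%N -> x < N%:R `^ e.
Proof.
move=> e0; exists (Num.truncn (`|x| `^ e^-1)).+1 => N NN.
apply: le_lt_trans (ler_norm x) _.
have -> : `|x| = (`|x| `^ e^-1) `^ e.
  by rewrite -powRrM mulVf ?powRr1 // gt_eqF.
rewrite lt_powRl // ?powR_ge0 //; apply: lt_le_trans (truncnS_gt _) _.
by rewrite ler_nat.
Qed.

End Alphabet.

Section WordSums.
Variable R : realType.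
Implicit Types (I : set nat) (s e x : R).

Lemma sum_wordsS ds k (f : seq nat -> R) :
  \sum_(w <- words ds k.+1) f w = \sum_(n <- ds) \sum_(w <- words ds k) f (n :: w).
Proof. by rewrite /= big_allpairs_dep. Qed.

Lemma cyl_powR w s : posw w -> cyl R w `^ s = 4 `^ s * (cyl R w / 4) `^ s.
Proof.
move=> pw; have c0 := cyl_gt0 R pw; rewrite -powRM //; last by lra.
by congr (_ `^ _); field.
Qed.

Variables (I : set nat) (s' : R).
Hypotheses (I0 : I `<=` [set n | (0 < n)%N]) (s'0 : 0 <= s').
Hypothesis null : hausdorff_measure s' (cf_set R I) = 0%E.

(** The factor 4^s undoes the normalisation in [pressure_lt1]; uniformity in [X] stands in for the
    infinite alphabet. *)
Lemma pressure_le X k s : s' < s ->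
  \sum_(w <- words (alph I X) k) cyl R w `^ s <= 4 `^ s.
Proof.
move=> ss'.
have := pressure_lt1 k I0 s'0 ss' null (alph_uniq I X) (@alph_sub I X).
move=> /ltW lt1; rewrite -[leRHS]mulr1; apply: le_trans (ler_wpM2l (powR_ge0 _ _) lt1).
rewrite big_distrr /= big_seq [leRHS]big_seq le_eqVlt; apply/orP; left; apply/eqP.
by apply: eq_bigr => w ww; rewrite cyl_powR // (all_words_pos (alph_pos I X) ww).
Qed.

(** Part of the exponent buys decay in the length: with s = r + d and s' < r, the sums of cyl^r stay
    bounded on each level while cyl^d is at most (2 / 2^k)^d, which leaves a geometric series. *)
Lemma total_pressure_le s : s' < s -> exists2 M : R, 0 < M & forall X K,
  \sum_(k < K) \sum_(w <- words (alph I X) k) cyl R w `^ s <= M.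
Proof.
move=> ss'; pose r := (s' + s) / 2; have s'r : s' < r by rewrite /r; lra.
pose d := s - r; have d0 : 0 < d by rewrite /d /r; lra.
pose q : R := 2^-1 `^ d.
have q0 : 0 < q by rewrite powR_gt0.
have q1 : q < 1.
  by have := @lt_powRl _ d 2^-1 1 d0; rewrite powR1; apply; lra.
exists (4 `^ r * 2 `^ d / (1 - q)).
  by rewrite divr_gt0 ?mulr_gt0 ?powR_gt0 // subr_gt0.
move=> X K; apply: (@le_trans _ _ (\sum_(k < K) 4 `^ r * 2 `^ d * q ^+ k)).
  apply: ler_sum => k _.
  apply: (@le_trans _ _ (\sum_(w <- words (alph I X) k) cyl R w `^ r * (2 `^ d * q ^+ k))).
    rewrite big_seq [leRHS]big_seq; apply: ler_sum => w ww.
    have pw := all_words_pos (alph_pos I X) ww; have c0 := cyl_gt0 R pw.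
    have -> : s = r + d by rewrite /d; lra.
    rewrite powRD ?(gt_eqF c0) ?implybT // ler_wpM2l ?powR_ge0 //.
    have -> : 2 `^ d * q ^+ k = (2 / 2 ^+ k) `^ d.
      rewrite /q -powR_mulrn ?powR_ge0 // powRAC -powRM //.
      by rewrite powR_mulrn ?invr_ge0 // exprVn.
    rewrite le_powRl ?(ltW d0) ?(ltW c0) //; apply: le_trans (cyl_le_size R pw) _.
    by move: ww; rewrite mem_words => /andP[/eqP ->].
  rewrite -big_distrl /= -mulrA ler_wpM2r ?pressure_le //.
  by rewrite mulr_ge0 ?powR_ge0 // exprn_ge0 // ltW.
rewrite -big_distrr /= ler_wpM2l ?mulr_ge0 ?powR_ge0 //.
have -> : \sum_(i < K) q ^+ i = (1 - q ^+ K) / (1 - q).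
  by rewrite -[1 - q ^+ K]opprB subrX1 -mulNr opprB mulrC mulKf // subr_eq0 gt_eqF.
rewrite ler_pdivrMr ?subr_gt0 // mulVf ?subr_eq0 ?gt_eqF //.
by rewrite lerBlDr lerDl exprn_ge0 // ltW.
Qed.

Lemma null_exponent_ge_half s :
  limn_esup (fun N : nat => (ln (count_upto I N)%:R / ln N%:R : R)%:E) = 1%E ->
  s' < s -> 1 / 2 <= s.
Proof.
move=> lim1 ss'; rewrite leNgt; apply/negP => s2.
have s0 : 0 < s by exact: le_lt_trans ss'.
(* About N^(1-e) words of length 1 contribute at least N^(-2s) each; with this [e] their sum is at
   least N^e, which is unbounded. *)
pose e := 1 / 2 - s; have e01 : 0 < e < 1 by rewrite /e; lra.
have /andP[e0 _] := e01.
have [N0 N0P] := exists_large_powR (4 `^ s) e0.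
have [N NN dens] := density_frequently (maxn 1 N0) e01 lim1.
move: NN; rewrite geq_max => /andP[N1 NN].
have := N0P N NN; rewrite ltNge => /negP; apply.
have Npos : (0 : R) < N%:R by rewrite ltr0n.
apply: le_trans (pressure_le N 1 ss').
rewrite sum_wordsS big_seq.
apply: (@le_trans _ _ (\sum_(n <- alph I N | n \in alph I N) (N%:R ^- 2) `^ s)).
  rewrite -big_seq big_const_seq count_predT iter_addr_0 -[_ *+ size _]mulr_natl.
  apply: le_trans (ler_wpM2r (powR_ge0 _ _) dens).
  rewrite -powR_invn ?(ltW Npos) // -powRrM -powRD ?(gt_eqF Npos) ?implybT //.
  by rewrite (_ : 1 - e + 1 *- 2 * s = e) //; rewrite /e; lra.
apply: ler_sum => n; rewrite mem_alph => /and3P[_ n0 nN].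
rewrite /= big_seq1 cyl1 le_powRl ?invr_ge0 ?exprn_ge0 ?(ltW s0) //.
rewrite lef_pV2 ?posrE ?exprn_gt0 ?ltr0n // lerXn2r ?nnegrE ?ler0n //.
by rewrite ler_nat.
Qed.

End WordSums.

(** * Packing of cylinders near a ball *)

Section Packing.
Variable R : realType.
Implicit Types (u v w : seq nat) (x y r A B : R).

(** Induction in the manner of quicksort: the first interval splits the others into those on its
    left and those on its right. *)
Lemma sum_ordered_itv (T : eqType) (a b : T -> R) (s : seq T) A B : uniq s ->
  {in s, forall i, A <= a i /\ a i <= b i /\ b i <= B} ->
  {in s &, forall i j, i != j -> b i <= a j \/ b j <= a i} -> A <= B ->
  \sum_(i <- s) (b i - a i) <= B - A.
Proof.
have [n] := ubnP (size s); elim: n s A B => // n IH [|i s] A B.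
  by move=> _ _ _ _ AB; rewrite big_nil subr_ge0.
rewrite /= ltnS => sn /andP[iNs us] inAB ord AB; rewrite big_cons.
have [Aa [ab bB]] := inAB i (mem_head _ _).
rewrite (bigID (fun j => b j <= a i)) /= -big_filter -[X in _ + (_ + X)]big_filter.
have L : \sum_(j <- [seq j <- s | b j <= a i]) (b j - a j) <= a i - A.
  apply: IH => //.
  - by rewrite (leq_ltn_trans _ sn) // size_filter count_size.
  - exact: seq.filter_uniq.
  - move=> j; rewrite mem_filter => /andP[ba js].
    by have [? []] := inAB j (mem_behead (s := i :: s) js).
  - move=> j k; rewrite !mem_filter => /andP[_ js] /andP[_ ks].
    by apply: ord; rewrite inE ?js ?ks orbT.
have Rt : \sum_(j <- [seq j <- s | ~~ (b j <= a i)]) (b j - a j) <= B - b i.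
  apply: IH => //.
  - by rewrite (leq_ltn_trans _ sn) // size_filter count_size.
  - exact: seq.filter_uniq.
  - move=> j; rewrite mem_filter => /andP[ba js].
    have [? [? ?]] := inAB j (mem_behead (s := i :: s) js); split => //.
    have ji : j != i by apply: contraNneq iNs => <-.
    have [] := ord j i (mem_behead (s := i :: s) js) (mem_head _ _) ji => //.
    by rewrite (negbTE ba).
  - move=> j k; rewrite !mem_filter => /andP[_ js] /andP[_ ks].
    by apply: ord; rewrite inE ?js ?ks orbT.
by lra.
Qed.

(* The end points of a cylinder: [moeb w] is decreasing for words of odd length. *)
Definition cylo w : R := moeb w (odd (size w))%:R.
Definition cyhi w : R := moeb w (~~ odd (size w))%:R.

Lemma cylo_cons n w : cylo (n :: w) = (n%:R + cyhi w)^-1.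
Proof. by []. Qed.

Lemma cyhi_cons n w : cyhi (n :: w) = (n%:R + cylo w)^-1.
Proof. by rewrite /cyhi /= negbK. Qed.

Lemma cyl_ends w x : posw w -> 0 <= x <= 1 ->
  0 <= cylo w /\ cylo w <= moeb w x /\ moeb w x <= cyhi w /\ cyhi w <= 1.
Proof.
move=> + x01; elim: w => [_|n w IH] /=.
  by rewrite /cylo /cyhi /=; lra.
move=> /andP[n0 /IH [l0 [lm [mh h1]]]]; rewrite cylo_cons cyhi_cons.
have n1 : (1 : R) <= n%:R by rewrite ler1n.
rewrite invr_ge0 invf_le1 ?lef_pV2 ?posrE; repeat split; lra.
Qed.

Lemma cyl_len w : posw w -> cyhi w - cylo w = `|moeb w 0 - moeb w 1|.
Proof.
move=> pw; have [_ [l [h _]]] := cyl_ends pw (itv01_0 R).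
rewrite -[LHS]ger0_norm ?subr_ge0 ?(le_trans l h) //.
by rewrite /cyhi /cylo; case: odd => //=; rewrite distrC.
Qed.

(** Cylinders with different first digits lie in different intervals [1/(n+1), 1/n]; below a common
    first digit the order is reversed. *)
Lemma cyl_ordered u v : posw u -> posw v -> size u = size v -> u != v ->
  cyhi u <= cylo v \/ cyhi v <= cylo u.
Proof.
elim: u v => [|n u IH] [|m v] //= /andP[n0 pu] /andP[m0 pv] [suv].
have [lu0 [lu [uh uh1]]] := cyl_ends pu (itv01_0 R).
have [lv0 [lv [vh vh1]]] := cyl_ends pv (itv01_0 R).
have n1 : (1 : R) <= n%:R by rewrite ler1n.
have m1 : (1 : R) <= m%:R by rewrite ler1n.
rewrite !cylo_cons !cyhi_cons => nu_mv.
have [nm|nm|nm] := ltngtP n m.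
- right; have : n%:R + 1 <= m%:R :> R by rewrite natr1 ler_nat.
  by move=> ?; rewrite lef_pV2 ?posrE; lra.
- left; have : m%:R + 1 <= n%:R :> R by rewrite natr1 ler_nat.
  by move=> ?; rewrite lef_pV2 ?posrE; lra.
- subst m; have uv : u != v by apply: contra nu_mv => /eqP ->.
  by have [h|h] := IH v pu pv suv uv; [right|left]; rewrite lef_pV2 ?posrE; lra.
Qed.

(** All points of the cylinder count, not only those of the limit set, so that lengths of intervals
    can be compared. *)
Definition touches w x r := `[< exists2 y, 0 <= y <= 1 & `|x - moeb w y| < r >].

(** Cut every cylinder to [x - 2r, x + 2r]: having a point within r of x, it is either kept whole or
    keeps length at least r. The pieces do not overlap and lie in an interval of length 4r. *)
Lemma sum_min_len (W : seq (seq nat)) k x r : 0 < r -> uniq W ->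
  {in W, forall w, [&& posw w, size w == k & touches w x r]} ->
  \sum_(w <- W) Num.min (cyhi w - cylo w) r <= 4 * r.
Proof.
move=> r0 uW WP.
pose a w := Num.max (cylo w) (x - 2 * r).
pose b w := Num.min (cyhi w) (x + 2 * r).
have key w : w \in W -> Num.min (cyhi w - cylo w) r <= b w - a w /\
    a w <= b w.
  move=> /WP /and3P[pw _ /asboolP[y y01]]; rewrite ltr_norml => /andP[y1 y2].
  have [l0 [lm [mh h1]]] := cyl_ends pw y01.
  have H : Num.min (cyhi w - cylo w) r <= b w - a w.
    rewrite /a /b ge_min; apply/orP.
    have [h1'|h1'] := leP (cyhi w) (x + 2 * r);
      have [l1'|l1'] := leP (cylo w) (x - 2 * r).
    + by right; lra.
    + by left.
    + by right; lra.
    + by right; lra.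
  split => //; rewrite -subr_ge0; apply: le_trans H.
  rewrite le_min (ltW r0) andbT; lra.
apply: (@le_trans _ _ (\sum_(w <- W) (b w - a w))).
  by rewrite big_seq [leRHS]big_seq; apply: ler_sum => w /key[].
have -> : 4 * r = (x + 2 * r) - (x - 2 * r) by ring.
apply: sum_ordered_itv => //; last by lra.
- move=> w wW; have [_ ab] := key w wW; split; first by rewrite le_max lexx orbT.
  by split => //; rewrite ge_min lexx orbT.
- move=> u v uW' vW uv.
  have /and3P[pu /eqP su _] := WP u uW'; have /and3P[pv /eqP sv _] := WP v vW.
  have [h|h] := cyl_ordered pu pv (etrans su (esym sv)) uv; [left|right].
    by rewrite /a /b ge_min le_max h.
  by rewrite /a /b ge_min le_max h.
Qed.

Lemma cyl_len_ge w : posw w -> cyl R w / 2 <= cyhi w - cylo w.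
Proof. by move=> pw; rewrite cyl_len // moeb_len_ge. Qed.

Lemma count_large_cyl (W : seq (seq nat)) k x r : 0 < r -> uniq W ->
  {in W, forall w, [&& posw w, size w == k & touches w x r]} ->
  {in W, forall w, r <= cyl R w} -> (size W)%:R <= 8 :> R.
Proof.
move=> r0 uW WP Wr; have := sum_min_len r0 uW WP.
have : (size W)%:R * (r / 2) <= \sum_(w <- W) Num.min (cyhi w - cylo w) r.
  rewrite mulr_natl -[size W]count_predT -iter_addr_0 -big_const_seq.
  rewrite big_seq [leRHS]big_seq; apply: ler_sum => w wW.
  have /and3P[pw _ _] := WP w wW.
  by rewrite le_min; have := cyl_len_ge pw; have := Wr w wW; lra.
move=> /le_trans /[apply]; rewrite -ler_pdivlMr ?divr_gt0 // => /le_trans; apply.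
by rewrite le_eqVlt; apply/orP; left; apply/eqP; field; rewrite gt_eqF.
Qed.

Lemma sum_small_cyl (W : seq (seq nat)) k x r : 0 < r -> uniq W ->
  {in W, forall w, [&& posw w, size w == k & touches w x r]} ->
  {in W, forall w, cyl R w < r} -> \sum_(w <- W) cyl R w <= 8 * r.
Proof.
move=> r0 uW WP Wr; have := sum_min_len r0 uW WP.
have : \sum_(w <- W) cyl R w / 2 <= \sum_(w <- W) Num.min (cyhi w - cylo w) r.
  rewrite big_seq [leRHS]big_seq; apply: ler_sum => w wW.
  have /and3P[pw _ _] := WP w wW.
  rewrite le_min; have := cyl_len_ge pw; have := Wr w wW.
  by have := cyl_gt0 R pw; lra.
rewrite -big_distrl /=; lra.
Qed.

End Packing.

(** * Stopping words and covers of the limit set *)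

Section Stopping.
Variables (R : realType) (I : set nat).
Hypothesis I0 : I `<=` [set n | (0 < n)%N].
Implicit Types (tau rho s x y z : R) (u v w : seq nat).

Lemma posw_I u : {in u, forall m, I m} -> posw u.
Proof. by move=> uI; apply/allP => m /uI /I0. Qed.

Lemma cf_set_itv y : cf_set R I y -> 0 <= y <= 1.
Proof. by move=> [/andP[y0 y1] _]; rewrite !ltW. Qed.

Lemma cf_set_moeb u y : {in u, forall m, I m} -> cf_set R I y ->
  cf_set R I (moeb u y).
Proof.
rewrite cf_setE // => + [b bI <-]; elim: u => [|n u IH] uI /=; first by exists b.
have [c cI cE] := IH (fun m mu => uI m (mem_behead (s := n :: u) mu)).
exists (fun m => if m is j.+1 then c j else n).
  by case=> [|j] //=; apply: uI; rewrite mem_head.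
rewrite cfval_cons /=; first by rewrite (_ : (fun _ => _) = c) // cE.
by case=> [|j] /=; apply: I0 => //; apply: uI; rewrite mem_head.
Qed.

(** [u] is the last prefix before the size first drops below [tau]; it exists because the empty word
    has size 1. *)
Lemma cf_set_stop tau z : 0 < tau <= 1 -> cf_set R I z -> exists u n y,
  [/\ {in u, forall m, I m}, I n, cf_set R I y & z = moeb (u ++ [:: n]) y] /\
  cyl R (u ++ [:: n]) < tau <= cyl R u.
Proof.
move=> /andP[tau0 tau1]; rewrite {1}cf_setE // => -[b bI <-].
have pb : posd b by move=> m; apply: I0.
have ex : exists k, cyl R (mkseq b k) < tau.
  have [k ks] := exists_half_pow_lt tau0; exists k.
  apply: le_lt_trans ks; apply: le_trans (cyl_le_size R (posw_mkseq k pb)) _.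
  by rewrite size_mkseq.
have [k kP kmin] := ex_minnP ex.
case: k kP kmin => [|k]; first by rewrite cyl_nil ltNge tau1.
rewrite mkseqS -cats1 => kP kmin.
exists (mkseq b k), (b k), (cfval R (fun n => b (k.+1 + n)%N)).
split; [split|].
- by move=> m /mapP[i _ ->].
- exact: bI.
- by rewrite cf_setE //; exists (fun n => b (k.+1 + n)%N) => // n; apply: bI.
- by rewrite cats1 -mkseqS -cfval_cat.
- by rewrite kP leNgt; apply/negP => /kmin; rewrite ltnn.
Qed.

Definition words_lt ds K := flatten [seq words ds k | k <- iota 0 K].

Lemma mem_words_lt ds K w :
  (w \in words_lt ds K) = (size w < K)%N && all (mem ds) w.
Proof.
apply/flatten_mapP/idP => [[k]|/andP[wK wds]].
  by rewrite mem_iota mem_words => /= kK /andP[/eqP -> ->]; rewrite kK.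
by exists (size w); rewrite ?mem_iota ?mem_words ?eqxx.
Qed.

Lemma sum_words_lt ds K (f : seq nat -> R) :
  \sum_(w <- words_lt ds K) f w = \sum_(k < K) \sum_(w <- words ds k) f w.
Proof.
rewrite big_flatten big_map.
rewrite -(big_mkord predT (fun k => \sum_(w <- words ds k) f w)).
by rewrite /index_iota subn0.
Qed.

(** For cylinders of size at least [tau] the first inequality excludes digits above [X]
    ([cyl_digit]), the second lengths from [K] on ([cyl_le_size]). *)
Definition resolves tau (X K : nat) :=
  1 < X.+1%:R ^+ 2 * tau /\ 2 / 2 ^+ K < tau.

Lemma exists_resolves tau : 0 < tau -> exists X K, resolves tau X K.
Proof.
move=> tau0; have [K KP] := exists_half_pow_lt tau0.
exists (Num.truncn tau^-1), K; split => //.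
have := truncnS_gt tau^-1; set t : R := _%:R => tX.
have t1 : 1 <= t by rewrite ler1n.
rewrite -ltr_pdivrMr // div1r; apply: lt_le_trans tX _.
by rewrite expr2 ler_peMr // (le_trans ler01).
Qed.

Lemma resolves_mem tau X K u : 0 < tau -> resolves tau X K ->
  {in u, forall m, I m} -> tau <= cyl R u -> u \in words_lt (alph I X) K.
Proof.
move=> tau0 [XP KP] uI tu; have pu := posw_I uI.
rewrite mem_words_lt; apply/andP; split.
  rewrite ltnNge; apply/negP => Ku.
  have := le_trans tu (cyl_le_size R pu); rewrite leNgt => /negP; apply.
  apply: le_lt_trans KP; rewrite ler_pM2l // lef_pV2 ?posrE ?exprn_gt0 //.
  by rewrite ler_weXn2l ?ler1n.
apply/allP => m mu; rewrite /= mem_alph.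
have Im := uI m mu; rewrite mem_set //= I0 //= leqNgt; apply/negP => Xm.
have := cyl_digit R pu mu; rewrite leNgt => /negP; apply.
apply: lt_le_trans XP _; apply: ler_pM => //; first by rewrite ltW.
by rewrite lerXn2r ?nnegrE ?ler0n // ler_nat.
Qed.

(* Contains the points of the cylinder of [u] whose next digit makes the
   cylinder smaller than [rho]. *)
Definition tail u rho : set R :=
  [set moeb u x | x in [set x | 0 <= x <= 1 /\ x ^+ 2 <= 4 * rho / cyl R u]].

(** The digit satisfies cyl u / (4 n^2) <= cyl (u n) < rho, and the parameter 1/(n + y) is at most
    1/n. *)
Lemma mem_tail u n y rho : posw u -> (0 < n)%N -> 0 <= y <= 1 ->
  cyl R (u ++ [:: n]) < rho -> tail u rho (moeb (u ++ [:: n]) y).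
Proof.
move=> pu n0 y01 unr; have cu := cyl_gt0 R pu.
have n1 : (1 : R) <= n%:R by rewrite ler1n.
have pn : posw [:: n] by rewrite /posw /= n0.
have /andP[y0 y1] := y01.
exists (n%:R + y)^-1; last by rewrite moeb_cat.
rewrite -/(moeb [:: n] y); split; first exact: moeb_itv.
have := le_lt_trans (cyl_cat_ge R pu pn) unr; rewrite cyl1 => H.
apply: (@le_trans _ _ (n%:R ^- 2)).
  rewrite exprVn lef_pV2 ?posrE ?exprn_gt0 ?lerXn2r ?nnegrE //; lra.
rewrite ler_pdivlMr // mulrC ltW //; move: H; rewrite ltr_pdivrMr //; lra.
Qed.

(** Parameters run up to 2 (rho / cyl u)^(1/2) and [moeb u] contracts by cyl u, so the diameter is
    at most 2 (rho cyl u)^(1/2). *)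
Lemma dcov_tail u rho : posw u -> 0 < rho <= cyl R u ->
  dcov rho (9 * (cyl R u / rho) `^ 2^-1) (tail u rho).
Proof.
move=> pu /andP[r0 ru]; have cu := cyl_gt0 R pu.
have c0 : 0 <= cyl R u / rho by rewrite divr_ge0 // ltW.
have c1 : 1 <= cyl R u / rho by rewrite ler_pdivlMr // mul1r.
rewrite powR12_sqrt //.
set q := Num.sqrt (cyl R u / rho).
have q1 : 1 <= q by rewrite -sqrtr1 ler_wsqrtr.
have q2 : q ^+ 2 = cyl R u / rho by rewrite sqr_sqrtr.
apply: (@dcov_sub _ _ (4 * (2 * (rho * q)) / rho + 1) _ _ (tail u rho)) => //;
  last apply: dcov_diam => //.
- rewrite (_ : 4 * _ / rho = 8 * q); first by lra.
  by field; rewrite gt_eqF.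
- move=> _ _ [x [x01 xB] <-] [y [y01 yB] <-].
  apply: le_trans (moeb_dist_le pu x01 y01) _.
  have aux (a : R) : 0 <= a <= 1 -> a ^+ 2 <= 4 * rho / cyl R u ->
      a <= 2 * (rho * q) / cyl R u.
    move=> /andP[a0 _] aB; rewrite -(ler_pXn2r (n := 2)) ?nnegrE //; last first.
      by rewrite divr_ge0 ?mulr_ge0 // ?ltW //; lra.
    apply: le_trans aB _; rewrite exprMn exprMn exprMn q2.
    rewrite le_eqVlt; apply/orP; left; apply/eqP.
    by field; rewrite !gt_eqF.
  have xa := aux x x01 xB; have ya := aux y y01 yB.
  rewrite mulrC -ler_pdivlMr //; move: x01 y01 => /andP[? ?] /andP[? ?].
  by rewrite ler_norml; lra.
- by rewrite !mulr_ge0 // ?ltW //; lra.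
Qed.

(** Every point lies in the tail of a word with cylinder at least rho. The cost exponent 1/2 is
    raised to s since cyl u / rho >= 1, and the sum of cyl^s over all words is at most M. *)
Lemma dcov_cf_set s M : 2^-1 <= s ->
  (forall X K, \sum_(k < K) \sum_(w <- words (alph I X) k) cyl R w `^ s <= M) ->
  forall rho, 0 < rho <= 1 -> dcov rho (9 * M * rho^-1 `^ s) (cf_set R I).
Proof.
move=> s2 HM rho r01; have /andP[r0 r1] := r01.
have [X [K res]] := exists_resolves r0.
pose W := [seq u <- words_lt (alph I X) K | rho <= cyl R u].
have ir0 : 0 <= rho^-1 by rewrite invr_ge0 ltW.
have pW u : u \in W -> posw u /\ rho <= cyl R u.
  rewrite mem_filter mem_words_lt => /and3P[-> _ /allP ud]; split => //.
  by apply: posw_I => m /ud /alph_sub.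
have cov : {in W, forall u, dcov rho (9 * (cyl R u / rho) `^ s) (tail u rho)}.
  move=> u /pW[pu ru].
  apply: dcov_sub (dcov_tail pu _) => //; last by rewrite r0.
  by rewrite ler_pM2l // ler_powR // ler_pdivlMr // mul1r.
apply: dcov_sub (dcov_seq cov).
- move=> z /(cf_set_stop r01)[u [n [y [[uI nI yF ->] /andP[unr ru]]]]].
  exists u; first by rewrite mem_filter ru (resolves_mem r0 res).
  by apply: mem_tail => //; [exact: posw_I | exact: I0 | exact: cf_set_itv].
- rewrite -big_distrr /= -mulrA ler_pM2l //.
  apply: (@le_trans _ _ (\sum_(u <- words_lt (alph I X) K) (cyl R u * rho^-1) `^ s)).
    rewrite big_filter [leRHS](bigID (fun u => rho <= cyl R u)) /= lerDl.
    by apply: sumr_ge0 => u _; exact: powR_ge0.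
  rewrite sum_words_lt; apply: (@le_trans _ _ ((\sum_(k < K)
     \sum_(w <- words (alph I X) k) cyl R w `^ s) * rho^-1 `^ s)).
    rewrite mulr_suml; apply: ler_sum => k _; rewrite mulr_suml.
    rewrite big_seq [leRHS]big_seq; apply: ler_sum => w ww.
    have pw := all_words_pos (alph_pos I X) ww.
    by rewrite powRM // ltW // cyl_gt0.
  by rewrite ler_wpM2r ?powR_ge0.
Qed.

End Stopping.

(** * Covers of the part of the limit set in a ball *)

Section BallCovering.
Variables (R : realType) (I : set nat).
Hypothesis I0 : I `<=` [set n | (0 < n)%N].
Implicit Types (rho s x y z : R) (u v w : seq nat).

Lemma sum_words_rcons ds k (f : seq nat -> R) :
  \sum_(w <- words ds k.+1) f w =
  \sum_(u <- words ds k) \sum_(n <- ds) f (u ++ [:: n]).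
Proof.
elim: k f => [|k IH] f.
  by rewrite sum_wordsS /= big_seq1; apply: eq_bigr => n _; rewrite big_seq1.
rewrite sum_wordsS [RHS]sum_wordsS; apply: eq_bigr => n _.
by rewrite (IH (fun w => f (n :: w))).
Qed.

Lemma posw_cat1 u n : posw u -> (0 < n)%N -> posw (u ++ [:: n]).
Proof. by rewrite /posw all_cat /= => -> ->. Qed.

Variables (x r rho s : R) (X K : nat).
Hypotheses (r01 : 0 < r <= 1) (rho0 : 0 < rho) (rhor : rho <= r ^+ 2).
Hypotheses (s2 : 2^-1 <= s) (s1 : s <= 1).
Hypotheses (XP : 1 < X.+1%:R ^+ 2 * rho) (KP : 2 / 2 ^+ K < r).

Let ds := alph I X.
Let big u := (r <= cyl R u) && touches u x r.
Let small v := (cyl R v < r) && touches v x r.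
(** Digits by which a word crosses the scale r but not yet rho; those jumping below rho at once are
    left to [tail]. *)
Let mid u := [seq n <- ds | (rho <= cyl R (u ++ [:: n])) && small (u ++ [:: n])].
(* [T] is r^-1 * (r^2 / rho)^s, the size of the cover up to logarithms. *)
Let T := r `^ (2 * s - 1) * rho^-1 `^ s.
Let H : R := \sum_(n <- ds) n%:R^-1.

Lemma pos_words k w : w \in words ds k -> posw w.
Proof. exact: all_words_pos (alph_pos I X). Qed.

Lemma count_big : \sum_(u <- words_lt ds K | big u) 1 <= 8 * K%:R :> R.
Proof.
have /andP[r0 _] := r01.
rewrite big_mkcond sum_words_lt; apply: (@le_trans _ _ (\sum_(k < K) 8)); last first.
  by rewrite sumr_const card_ord -[_ *+ K]mulr_natr.
apply: ler_sum => k _; rewrite -big_mkcond -big_filter.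
rewrite big_const_seq count_predT iter_addr_0.
apply: (@count_large_cyl _ _ k x r) => //.
- by rewrite seq.filter_uniq // words_uniq // alph_uniq.
- move=> w; rewrite mem_filter => /andP[/andP[_ ->] ww].
  rewrite (pos_words ww) andbT /=.
  by move: ww; rewrite mem_words => /andP[].
- by move=> w; rewrite mem_filter => /andP[/andP[]].
Qed.

(** Each pair of a word and a middle digit is a word of the next level, and on each level
    [sum_small_cyl] bounds the total size by 8r. *)
Lemma sum_mid : \sum_(u <- words_lt ds K | big u)
  \sum_(n <- mid u) cyl R (u ++ [:: n]) <= 8 * r * K%:R.
Proof.
have /andP[r0 _] := r01.
have cyl0 k u n : u \in words ds k -> n \in ds -> 0 <= cyl R (u ++ [:: n]).
  move=> uw nds; apply/ltW/cyl_gt0/posw_cat1; first exact: pos_words uw.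
  exact: (allP (alph_pos I X) _ nds).
apply: (@le_trans _ _ (\sum_(k < K) \sum_(v <- words ds k.+1 | small v) cyl R v)).
  rewrite big_mkcond sum_words_lt; apply: ler_sum => k _.
  rewrite [leRHS]big_mkcond sum_words_rcons big_seq [leRHS]big_seq.
  apply: ler_sum => u uw.
  have pos n : n \in ds -> 0 <= if small (u ++ [:: n]) then cyl R (u ++ [:: n]) else 0.
    by move=> nds; case: ifP => // _; exact: cyl0 uw nds.
  case: (big u); last first.
    by rewrite big_seq; apply: sumr_ge0 => n; exact: pos.
  rewrite big_filter big_mkcond big_seq [leRHS]big_seq; apply: ler_sum => n nds.
  have := pos n nds; case: (rho <= _) => //=.
apply: (@le_trans _ _ (\sum_(k < K) 8 * r)); last first.
  by rewrite sumr_const card_ord -[_ *+ K]mulr_natr.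
apply: ler_sum => k _; rewrite -big_filter.
apply: (@sum_small_cyl _ _ k.+1 x r) => //.
- by rewrite seq.filter_uniq // words_uniq // alph_uniq.
- move=> w; rewrite mem_filter => /andP[/andP[_ ->] ww].
  rewrite (pos_words ww) andbT.
  by move: ww; rewrite mem_words => /andP[].
- by move=> w; rewrite mem_filter => /andP[/andP[]].
Qed.

Lemma ratio_ge1 : 1 <= r ^+ 2 / rho.
Proof. by rewrite ler_pdivlMr // mul1r. Qed.

(** (cyl u / rho)^(1/2) <= rho^(-1/2) = r^-1 (r^2 / rho)^(1/2), and the exponent may be raised to s
    since r^2 >= rho. *)
Lemma tail_cost u : posw u -> (cyl R u / rho) `^ 2^-1 <= T.
Proof.
have /andP[r0 r1] := r01.
move=> pu; apply: (@le_trans _ _ (rho^-1 `^ 2^-1)).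
  apply: le_powRl => //; first by rewrite divr_ge0 ?(ltW rho0) // ltW // cyl_gt0.
  by rewrite ler_piMl ?cyl_le1 // invr_ge0 ltW.
have E t : r `^ (2 * t - 1) * rho^-1 `^ t = r^-1 * (r ^+ 2 / rho) `^ t.
  rewrite powRM ?exprn_ge0 ?invr_ge0 ?(ltW rho0) ?(ltW r0) // mulrA; congr (_ * _).
  rewrite powRB ?(gt_eqF r0) ?implybT // powRr1 ?(ltW r0) // mulrC powRrM.
  by rewrite powR_mulrn // ltW.
have <- : r `^ (2 * 2^-1 - 1) * rho^-1 `^ 2^-1 = rho^-1 `^ 2^-1.
  by rewrite mulfV // subrr powRr0 mul1r.
rewrite /T !E ler_pM2l ?invr_gt0 //.
by rewrite ler_powR // ratio_ge1.
Qed.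

(** Write c for the cylinder. If c <= r^2, then c^s = c^(s-1/2) c^(1/2) <= r^(2s-1) / n; if c > r^2,
    then c^s = c c^(s-1) <= r^(2s-1) c / r, as s <= 1. The first terms sum to at most [H], the
    second ones are bounded by [sum_mid]. *)
Lemma mid_cost u n : posw u -> (0 < n)%N -> rho <= cyl R (u ++ [:: n]) ->
  (cyl R (u ++ [:: n]) / rho) `^ s <= T * (n%:R^-1 + cyl R (u ++ [:: n]) / r).
Proof.
have /andP[r0 r1] := r01.
move=> pu n0 rc; have pn : posw [:: n] by rewrite /posw /= n0.
set c := cyl R _ in rc *.
have c0 : 0 < c by exact: lt_le_trans rc.
have nR : (0 : R) < n%:R by rewrite ltr0n.
have rpos t : 0 < r `^ t by exact: powR_gt0.
rewrite powRM ?(ltW c0) ?invr_ge0 ?(ltW rho0) // /T mulrAC ler_wpM2r ?powR_ge0 //.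
have [cr|rc2] := leP c (r ^+ 2).
  apply: (@le_trans _ _ (r `^ (2 * s - 1) * n%:R^-1)); last first.
    by rewrite ler_wpM2l ?(ltW (rpos _)) // lerDl divr_ge0 ?ltW.
  rewrite (_ : s = (s - 2^-1) + 2^-1); last by rewrite subrK.
  rewrite powRD ?(gt_eqF c0) ?implybT //.
  apply: ler_pM; rewrite ?powR_ge0 //.
    rewrite (_ : 2 * (s - 2^-1 + 2^-1) - 1 = 2 * (s - 2^-1)); last by field.
    rewrite powRrM powR_mulrn ?(ltW r0) //; apply: le_powRl; rewrite ?(ltW c0) //.
    by rewrite subr_ge0.
  have -> : n%:R^-1 = (n%:R ^- 2) `^ 2^-1 :> R.
    by rewrite powR12_sqrt ?invr_ge0 ?exprn_ge0 // -exprVn sqrtr_sqr ger0_norm // invr_ge0.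
  apply: le_powRl; rewrite ?(ltW c0) //.
  apply: le_trans (cyl_cat_le R pu pn) _; rewrite cyl1 ler_piMl ?cyl_le1 //.
apply: (@le_trans _ _ (r `^ (2 * s - 1) * (c / r))); last first.
  by rewrite ler_wpM2l ?(ltW (rpos _)) // lerDr invr_ge0.
rewrite {1}(_ : s = 1 + (s - 1)); last by rewrite addrC subrK.
rewrite powRD ?(gt_eqF c0) ?implybT // powRr1 ?(ltW c0) // mulrCA.
rewrite ler_wpM2l ?(ltW c0) //.
have -> : r `^ (2 * s - 1) / r = (r ^+ 2) `^ (s - 1).
  rewrite -powR_mulrn ?(ltW r0) // -powRrM -[in X in _ / X](powRr1 (ltW r0)).
  by rewrite -powRB ?(gt_eqF r0) ?implybT //; congr (_ `^ _); ring.
rewrite -[s - 1]opprB !powRN lef_pV2 ?posrE ?powR_gt0 ?exprn_gt0 //.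
by rewrite le_powRl ?subr_ge0 ?exprn_ge0 ?(ltW r0) ?(ltW rc2).
Qed.

(** Each big word pays for its tail and for the covers below its middle digits. The constant 72 is 9
    from those covers times 8 from the packing. *)
Lemma dcov_ball M : 0 < M ->
  (forall X K, \sum_(k < K) \sum_(w <- words (alph I X) k) cyl R w `^ s <= M) ->
  dcov rho (72 * K%:R * (1 + M * (H + 1)) * T) (ball x r `&` cf_set R I).
Proof.
move=> M0 HM; have /andP[r0 r1] := r01.
have r2r : r ^+ 2 <= r by rewrite expr2 ler_piMr // ltW.
have rhole1 : rho <= 1 by rewrite (le_trans rhor) // (le_trans r2r).
have res : resolves r X K.
  by split => //; apply: lt_le_trans XP _; rewrite ler_wpM2l ?exprn_ge0 // (le_trans rhor).
have T0 : 0 < T by rewrite mulr_gt0 // powR_gt0 // invr_gt0.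
have H0 : 0 <= H by apply: sumr_ge0 => n _; rewrite invr_ge0.
pose W := [seq u <- words_lt ds K | big u].
pose cost u := 9 * T + 9 * M * (T * (H + r^-1 * \sum_(n <- mid u) cyl R (u ++ [:: n]))).
pose A u := tail u rho `|`
  [set z | exists2 n, n \in mid u & (moeb (u ++ [:: n]) @` cf_set R I) z].
have pds n : n \in ds -> (0 < n)%N by exact: (allP (alph_pos I X)).
have pW u : u \in W -> posw u /\ big u.
  rewrite mem_filter mem_words_lt => /and3P[bu _ /allP ud]; split => //.
  by apply: (posw_I I0) => m /ud /alph_sub.
have covn u : u \in W -> dcov rho (9 * M * (T * (H + r^-1 * \sum_(n <- mid u) cyl R (u ++ [:: n]))))
    [set z | exists2 n, n \in mid u & (moeb (u ++ [:: n]) @` cf_set R I) z].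
  move=> /pW[pu _].
  have midP n : n \in mid u -> [/\ (0 < n)%N, rho <= cyl R (u ++ [:: n]) & posw (u ++ [:: n])].
    rewrite mem_filter => /andP[/andP[rn _] /pds n0]; split => //.
    exact: posw_cat1.
  have c : {in mid u, forall n, dcov rho
      (9 * M * (T * (n%:R^-1 + cyl R (u ++ [:: n]) / r)))
      (moeb (u ++ [:: n]) @` cf_set R I)}.
    move=> n /midP[n0 rn pun]; have c0 := cyl_gt0 R pun.
    (* A cover of the whole limit set at scale rho / cyl is pushed forward by the contraction. *)
    have -> : rho = cyl R (u ++ [:: n]) * (rho / cyl R (u ++ [:: n])).
      by rewrite mulrCA divff ?mulr1 // gt_eqF.
    apply: dcov_image => // [y z yF zF|].
      exact: moeb_dist_le (cf_set_itv yF) (cf_set_itv zF).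
    apply: dcov_sub (dcov_cf_set I0 s2 HM _) => //.
      rewrite invf_div ler_wpM2l ?mulr_ge0 ?(ltW M0) //; exact: mid_cost.
    by rewrite divr_gt0 //= ler_pdivrMr // mul1r.
  apply: dcov_sub (dcov_seq c) => //.
  rewrite -!big_distrr /= !ler_wpM2l ?(ltW T0) ?mulr_ge0 ?(ltW M0) //.
  rewrite big_split /= -mulr_suml [_ * r^-1]mulrC lerD2r /H /mid big_filter.
  rewrite big_mkcond; apply: ler_sum => n _.
  by case: ifP => _ //; rewrite invr_ge0.
have cov : {in W, forall u, dcov rho (cost u) (A u)}.
  move=> u uW; have [pu /andP[bu _]] := pW u uW.
  apply: dcovU (covn u uW); apply: dcov_sub (dcov_tail pu _) => //.
    by rewrite ler_pM2l // tail_cost.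
  by rewrite rho0 (le_trans rhor) // (le_trans r2r).
apply: dcov_sub (dcov_seq cov).
- move=> z [xz zF]; have [u [n [y [[uI nI yF zE] /andP[unr ru]]]]] := cf_set_stop I0 r01 zF.
  have pu := posw_I I0 uI; have n0 := I0 nI.
  have pn : posw [:: n] by rewrite /posw /= n0.
  have y01 := cf_set_itv yF.
  have tch v y' : 0 <= y' <= 1 -> z = moeb v y' -> touches v x r.
    by move=> y'01 E; apply/asboolP; exists y' => //; rewrite -E.
  have uW : u \in W.
    rewrite mem_filter (resolves_mem I0 r0 res) // andbT /big ru.
    by apply: (tch _ (moeb [:: n] y)); [exact: moeb_itv | rewrite zE moeb_cat].
  exists u => //; have [rc|cr] := leP rho (cyl R (u ++ [:: n])); last first.
    by left; rewrite zE; apply: mem_tail.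
  right; exists n; last by exists y.
  rewrite mem_filter rc /small unr (tch _ y) //=.
  (* A digit above [X] would make the cylinder smaller than rho. *)
  rewrite /ds mem_alph mem_set //= n0 leqNgt; apply/negP => Xn.
  have pun := posw_cat1 pu n0.
  have := cyl_digit R pun (n := n); rewrite mem_cat mem_seq1 eqxx orbT => /(_ isT).
  rewrite leNgt => /negP; apply; apply: lt_le_trans XP _.
  apply: ler_pM => //; first exact: ltW.
  by rewrite lerXn2r ?nnegrE ?ler0n // ler_nat.
- have total (h : R) (g : seq nat -> R) : \sum_(u <- words_lt ds K | big u)
      (9 * T + 9 * M * (T * (h + r^-1 * g u))) =
      T * (9 * (1 + M * h) * \sum_(u <- words_lt ds K | big u) 1 +
           9 * M * (r^-1 * \sum_(u <- words_lt ds K | big u) g u)).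
    rewrite !big_distrr /= -big_split /= big_distrr /=.
    by apply: eq_bigr => u _; ring.
  rewrite /W big_filter /cost total.
  rewrite mulrC ler_pM2r //.
  have cb := count_big; have sm := sum_mid.
  have e1 : 9 * (1 + M * H) * (\sum_(u <- words_lt ds K | big u) 1) <=
      9 * (1 + M * H) * (8 * K%:R) :> R.
    by rewrite ler_wpM2l // mulr_ge0 // addr_ge0 // mulr_ge0 // ltW.
  have e2 : 9 * M * (r^-1 * \sum_(u <- words_lt ds K | big u)
          \sum_(n <- mid u) cyl R (u ++ [:: n])) <= 9 * M * (r^-1 * (8 * r * K%:R)).
    by rewrite !ler_wpM2l ?mulr_ge0 ?invr_ge0 ?(ltW M0) ?(ltW r0).
  apply: le_trans (lerD e1 e2) _.
  rewrite (_ : r^-1 * (8 * r * K%:R) = 8 * K%:R); last by field; rewrite gt_eqF.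
  by rewrite le_eqVlt; apply/orP; left; apply/eqP; ring.
Qed.

End BallCovering.

(** * Upper bounds for the Assouad spectrum *)

Section SpectrumUpperBound.
Variable R : realType.
Implicit Types (r s e x y theta eta : R) (I : set nat).

Lemma spectrum_le theta alpha C (E : set R) : 0 < C ->
  (forall x r, 0 < r <= 1 ->
     dcov (r `^ theta^-1) (C * r `^ (alpha * (1 - theta^-1))) (ball x r `&` E)) ->
  (assouad_spectrum theta E <= alpha%:E)%E.
Proof.
move=> C0 H; apply: ereal_inf_lbound; exists alpha => //=; exists C; split => //.
by move=> x r _ r01; apply: covering_number_le; exact: H.
Qed.

(** The ball is an interval of length 2r, and 4 r / rho + 1 <= 5 r / rho. *)
Lemma spectrum_le1 theta (E : set R) : 0 < theta < 1 ->
  (assouad_spectrum theta E <= 1)%E.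
Proof.
move=> /andP[t0 t1]; apply: (@spectrum_le _ 1 5) => // x r /andP[r0 r1].
have rho0 : 0 < r `^ theta^-1 by exact: powR_gt0.
have rhor : r `^ theta^-1 <= r.
  rewrite -[leRHS](powRr1 (ltW r0)) ger_powR ?r0 //.
  by rewrite -invr1 lef_pV2 ?posrE // ltW.
apply: dcov_sub (@dcov_itv _ _ (x - r) (2 * r) (ball x r `&` E) rho0 _ _) => //.
- rewrite mul1r powRB ?(gt_eqF r0) ?implybT // powRr1 ?(ltW r0) //.
  have : 1 <= r / r `^ theta^-1 by rewrite ler_pdivlMr // mul1r.
  by rewrite mulrA -mulrA; lra.
- by move=> z [+ _]; rewrite /ball /= ltr_norml => /andP[? ?]; lra.
- by rewrite mulr_ge0 // ltW.
Qed.

Lemma ln_le_powR e y : 0 < e -> 0 < y -> ln y <= y `^ e / e.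
Proof.
move=> e0 y0; rewrite ler_pdivlMr // mulrC -ln_powR ltW // ln_sublinear //.
exact: powR_gt0.
Qed.

(** [K] is about the binary logarithm of 2/r, which any negative power of r absorbs. *)
Lemma exists_level_bound e : 0 < e -> exists A : R, forall r, 0 < r <= 1 ->
  exists2 K : nat, 2 / 2 ^+ K < r & K%:R <= A * r^-1 `^ e.
Proof.
move=> e0; have ln2 : 0 < ln 2 :> R by rewrite ln_gt0 // ltr1n.
exists (2 `^ e / e / ln 2 + 1) => r /andP[r0 r1].
have y0 : 0 < 2 / r by rewrite divr_gt0.
have y1 : 1 <= r^-1 by rewrite invf_ge1.
have lny : 0 <= ln (2 / r) / ln 2.
  by rewrite divr_ge0 ?(ltW ln2) // ln_ge0 // ler_pdivlMr // mul1r; lra.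
pose z := ln (2 / r) / ln 2; exists (Num.truncn z).+1.
  have := truncnS_gt z; move: (Num.truncn z).+1 => k; rewrite /z.
  rewrite ltr_pdivrMr // [_ * ln 2]mulr_natl -lnXn //.
  rewrite ltr_ln ?posrE ?exprn_gt0 // ltr_pdivrMr //.
  by rewrite mulrC -ltr_pdivrMr ?exprn_gt0.
rewrite -natr1 mulrDl mul1r; apply: lerD.
  apply: (@le_trans _ _ (ln (2 / r) / ln 2)); first by rewrite truncn_le.
  rewrite mulrAC ler_wpM2r ?invr_ge0 ?(ltW ln2) //.
  apply: le_trans (ln_le_powR e0 y0) _.
  by rewrite powRM ?invr_ge0 ?(ltW r0) // mulrAC.
by rewrite -[leLHS](powRr0 r^-1) ler_powR // ltW.
Qed.

(** The increments are controlled by ln(1 - t) <= -t; the case X = 0 uses that [ln] is 0 at 0. *)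
Lemma harmonic_le X : \sum_(n <- iota 1 X) n%:R^-1 <= 1 + ln X%:R :> R.
Proof.
elim: X => [|X IH]; first by rewrite big_nil ln0 // addr0.
have -> : iota 1 X.+1 = iota 1 X ++ [:: X.+1].
  by rewrite -[X in iota 1 X](addn1 X) iotaD.
rewrite big_cat /= big_seq1.
case: X IH => [_|X IH]; first by rewrite big_nil add0r invr1 ln1 addr0.
apply: le_trans (lerD IH (lexx _)) _; rewrite -addrA lerD2l.
have X1 : (0 : R) < X.+1%:R by rewrite ltr0n.
have X2 : (0 : R) < X.+2%:R by rewrite ltr0n.
suff : ln (X.+1%:R / X.+2%:R) <= - X.+2%:R^-1 :> R.
  rewrite ln_div ?posrE //.
  by move: (ln X.+1%:R) (ln X.+2%:R) (X.+2%:R^-1) => a b c; lra.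
have -> : X.+1%:R / X.+2%:R = 1 + (- X.+2%:R^-1) :> R.
  by rewrite -{1}[X.+1%:R](addrK 1) natr1 mulrBl divff ?gt_eqF // mul1r.
by apply: le_ln1Dx; rewrite ltrN2 invf_lt1 // ltr1n.
Qed.

Lemma sum_alph_inv_le I X : \sum_(n <- alph I X) n%:R^-1 <= 1 + ln X%:R :> R.
Proof.
apply: le_trans (harmonic_le X); rewrite big_filter big_mkcond.
by apply: ler_sum => n _; case: ifP => // _; rewrite invr_ge0.
Qed.

(** [X] is the integer part of rho^(-1/2), so the harmonic sum is logarithmic in 1/rho. *)
Lemma exists_digit_bound I e : 0 < e -> exists2 B : R, 0 < B &
  forall rho, 0 < rho <= 1 -> exists2 X : nat, 1 < X.+1%:R ^+ 2 * rho &
    \sum_(n <- alph I X) n%:R^-1 <= B * rho^-1 `^ e.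
Proof.
move=> e0; exists (1 + e^-1); first by rewrite addr_gt0 // invr_gt0.
move=> rho /andP[r0 r1]; have y0 : 0 < rho^-1 by rewrite invr_gt0.
have y1 : 1 <= rho^-1 by rewrite invf_ge1.
pose q := Num.sqrt rho^-1.
have q0 : 0 <= q by exact: sqrtr_ge0.
have q2 : q ^+ 2 = rho^-1 by rewrite sqr_sqrtr // ltW.
have q1 : 1 <= q by rewrite -sqrtr1 ler_wsqrtr.
have qy : q <= rho^-1 by rewrite -q2 expr2 ler_peMr.
exists (Num.truncn q).
  rewrite -ltr_pdivrMr // div1r -q2 ltrXn2r ?nnegrE //.
  by rewrite truncnS_gt.
apply: le_trans (sum_alph_inv_le _ _) _; rewrite mulrDl mul1r.
apply: lerD; first by rewrite -[leLHS](powRr0 rho^-1) ler_powR // ltW.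
rewrite mulrC; apply: le_trans (ln_le_powR e0 y0).
have t1 : (0 < Num.truncn q)%N by rewrite truncn_gt0.
rewrite ler_ln ?posrE ?ltr0n //; apply: le_trans qy.
by rewrite truncn_le.
Qed.

Lemma spectrum_le_small_theta I theta s' s eta :
  I `<=` [set n | (0 < n)%N] ->
  limn_esup (fun N : nat => (ln (count_upto I N)%:R / ln N%:R : R)%:E) = 1%E ->
  0 < theta < 1 / 2 -> 0 <= s' -> s' < s -> s <= 1 -> 0 < eta ->
  hausdorff_measure s' (cf_set R I) = 0%E ->
  (assouad_spectrum theta (cf_set R I) <=
     (s + theta / (1 - theta) * (1 - s) + eta)%:E)%E.
Proof.
move=> I0 lim1 /andP[t0 t2] s'0 s's s1 eta0 null.
have s2 : 2^-1 <= s by rewrite -div1r (null_exponent_ge_half I0 s'0 null lim1 s's).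
have [M M0 HM] := total_pressure_le I0 s'0 null s's.
have ti2 : 2 < theta^-1 by rewrite -[2]invrK ltf_pV2 ?posrE ?invr_gt0 //; lra.
(* The level count and the harmonic sum lose a factor r^-e each, and r^(-2e) is exactly the
   allowance r^(eta (1 - 1/theta)). *)
pose e := eta * (theta^-1 - 1) / 2.
have e0 : 0 < e by rewrite !mulr_gt0 //; lra.
have [A AP] := exists_level_bound e0.
(* The loss is stated in rho = r^(1/theta): rho^(-e theta) = r^-e. *)
have et0 : 0 < e * theta by rewrite mulr_gt0.
have [B B0 BP] := exists_digit_bound I et0.
have A0 : 0 <= A.
  have one : 0 < (1 : R) <= 1 by rewrite ltr01 lexx.
  have [K _] := AP 1 one.
  by rewrite invr1 powR1 mulr1; apply: le_trans.
apply: (@spectrum_le _ _ (72 * (A + 1) * (1 + M * (B + 1)))).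
  have A1 : 0 < A + 1 by rewrite ltr_wpDl.
  have B1 : 0 < 1 + M * (B + 1) by rewrite addr_gt0 // mulr_gt0 // addr_gt0.
  by rewrite mulr_gt0 // mulr_gt0.
move=> x r r01; have /andP[r0 r1] := r01.
set rho := r `^ theta^-1.
have rho0 : 0 < rho by exact: powR_gt0.
(* Here theta < 1/2 enters, as 1/theta > 2. *)
have rhor : rho <= r ^+ 2.
  by rewrite -powR_mulrn ?(ltW r0) // ger_powR ?r0 // ltW.
have rho1 : rho <= 1.
  by apply: le_trans rhor _; rewrite expr_le1 // ltW.
have [K KP KA] := AP r r01.
have [X XP XB] := BP rho (introT andP (conj rho0 rho1)).
apply: dcov_sub (dcov_ball I0 x r01 rho0 rhor s2 s1 XP KP M0 HM) => //.
set y := r^-1 in KA *; have y0 : 0 < y by rewrite invr_gt0.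
have y1 : 1 <= y by rewrite invf_ge1.
have rhoy : rho^-1 = y `^ theta^-1 by rewrite /y powRV // ltW.
have ry t : r `^ t = y `^ (- t).
  by rewrite /y powRV ?(ltW r0) // -powRN opprK.
rewrite rhoy -powRrM mulrCA mulVf ?gt_eqF // mulr1 in XB.
set H := \sum_(n <- _) _ in XB *.
have ye : 1 <= y `^ e by rewrite -[leLHS](powRr0 y) ler_powR // ltW.
have H0 : 0 <= H by apply: sumr_ge0 => n _; rewrite invr_ge0.
have K0 : K%:R <= (A + 1) * y `^ e.
  by apply: le_trans KA _; rewrite ler_wpM2r ?powR_ge0 // lerDl.
have H1 : 1 + M * (H + 1) <= (1 + M * (B + 1)) * y `^ e.
  rewrite mulrDl mul1r; apply: lerD => //; rewrite -mulrA ler_pM2l //.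
  by rewrite mulrDl mul1r; apply: lerD.
rewrite rhoy !ry -powRrM.
rewrite (_ : - ((s + theta / (1 - theta) * (1 - s) + eta) * (1 - theta^-1)) =
   e + e + (- (2 * s - 1) + theta^-1 * s)); last first.
  by rewrite /e; field; rewrite (gt_eqF t0) /=; apply: lt0r_neq0; lra.
rewrite !(powRD (x := y)) ?(gt_eqF y0) ?implybT //.
set p := _ `^ (- _) * _; set z := y `^ e in K0 H1 ye *.
have p0 : 0 <= p by rewrite mulr_ge0 ?powR_ge0.
rewrite [leRHS]mulrA ler_wpM2r //.
have -> : 72 * (A + 1) * (1 + M * (B + 1)) * (z * z) =
   (72 * ((A + 1) * z)) * ((1 + M * (B + 1)) * z) by ring.
apply: ler_pM => //.
- by rewrite addr_ge0 // mulr_ge0 ?addr_ge0 // ltW.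
- by rewrite ler_pM2l.
Qed.

End SpectrumUpperBound.

(** * Lower bounds for the Assouad spectrum *)

Section CoveringLowerBound.
Variable R : realType.
Implicit Types (rho m s c : R) (E A : set R) (I : set nat).

Lemma hausdorff_measure_ge0 s E : (0 <= hausdorff_measure s E)%E.
Proof.
apply: (@le_trans _ _ (hausdorff_pre s 1 E)); last first.
  by apply: ereal_sup_ubound; exists 1; rewrite /= ?ltr01.
apply: le_ereal_inf_tmp => _ [U _ <-]; apply: nneseries_ge0 => i _ _.
exact: hausdorff_gauge_ge0.
Qed.

Lemma hausdorff_gauge_le s rho E : 0 <= s -> 0 <= rho -> (diam E <= rho%:E)%E ->
  (hausdorff_gauge s E <= (rho `^ s)%:E)%E.
Proof.
move=> s0 r0 dr; rewrite /hausdorff_gauge; case: ifPn => [_|/set0P[x Ex]].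
  by rewrite lee_fin powR_ge0.
have := le_diam Ex Ex; rewrite subrr normr0.
move: dr; case: (diam E) => // d; rewrite poweR_EFin !lee_fin => dr d0.
exact: le_powRl.
Qed.

(** The cover is padded by empty sets, which cost 0 and have diameter -oo. The guard n > 0 matches
    [dcov_lower], where rho <= delta is deduced from n rho^s < delta^s. *)
Lemma hausdorff_pre_le s rho delta (n : nat) (U : nat -> set R) E :
  0 <= s -> 0 < rho -> ((0 < n)%N -> rho <= delta) ->
  (forall x, E x -> exists2 i, (i < n)%N & U i x) ->
  (forall i x y, U i x -> U i y -> `|x - y| < rho) ->
  (hausdorff_pre s delta E <= (n%:R * rho `^ s)%:E)%E.
Proof.
move=> s0 r0 rd EU Ur.
pose V i := if (i < n)%N then U i else set0.
have dV i : (i < n)%N -> (diam (V i) <= rho%:E)%E.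
  move=> ii; apply: ge_ereal_sup => _ [[x y] [/= + +] <-].
  by rewrite /V ii => Ux Uy; rewrite lee_fin ltW // (Ur i).
have V0 i : (n <= i)%N -> V i = set0 by rewrite /V leqNgt => /negbTE ->.
apply: (@le_trans _ _ (\sum_(i <oo) hausdorff_gauge s (V i))%E).
  apply: ereal_inf_lbound; exists V => //; split.
    move=> i; have [ii|ni] := ltnP i n; last by rewrite V0 // diam_set0 leNye.
    by apply: le_trans (dV i ii) _; rewrite lee_fin rd // (leq_ltn_trans _ ii).
  by move=> x /EU[i ii Ui]; exists i => //; rewrite /V ii.
rewrite (@nneseries_split _ _ 0 n); last by move=> k _; exact: hausdorff_gauge_ge0.
rewrite add0n eseries0 ?adde0; last first.
  by move=> i ni _; rewrite V0 // /hausdorff_gauge eqxx.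
apply: (@le_trans _ _ (\sum_(0 <= i < n) (rho `^ s)%:E)%E).
  rewrite big_nat [leRHS]big_nat; apply: lee_sum => i /andP[_ ii].
  by apply: hausdorff_gauge_le => //; rewrite ?(ltW r0) ?dV.
by rewrite sumEFin lee_fin big_const_nat subn0 iter_addr_0 mulr_natl.
Qed.

(** Without such a constant n rho^s can be made arbitrarily small; once below delta^s it forces rho
    <= delta, so the s-dimensional measure vanishes and s is at least the dimension. *)
Lemma dcov_lower s E : 0 < s -> (s%:E < hausdorff_dim E)%E ->
  exists2 c : R, 0 < c & forall rho m, 0 < rho <= 1 -> dcov rho m E ->
    c * rho^-1 `^ s <= m.
Proof.
move=> s0 sh; apply: contrapT => no.
have {}no c : 0 < c -> exists rho m, [/\ 0 < rho <= 1, dcov rho m E &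
    m < c * rho^-1 `^ s].
  move=> c0; apply: contrapT => no'; apply: no; exists c => // rho m r01 Em.
  by rewrite leNgt; apply/negP => mc; apply: no'; exists rho, m.
suff H0 : hausdorff_measure s E = 0%E.
  move: sh; rewrite ltNge => /negP; apply; apply: ereal_inf_lbound.
  by exists s => //; split => //; exact: ltW.
apply/eqP; rewrite eq_le hausdorff_measure_ge0 andbT.
apply: ge_ereal_sup => _ [delta d0 <-]; apply/lee_addgt0Pr => eps e0.
rewrite add0e.
have ds0 : 0 < delta `^ s by exact: powR_gt0.
have c0 : 0 < Num.min eps (delta `^ s) by rewrite lt_min e0.
have [rho [m [/andP[r0 r1] [n [U [nm EU Ur]]] mc]]] := no _ c0.
have rs0 : 0 < rho `^ s by exact: powR_gt0.
have : n%:R * rho `^ s < Num.min eps (delta `^ s).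
  rewrite -ltr_pdivlMr //; apply: le_lt_trans nm _.
  by rewrite powRV // in mc; exact: ltW.
rewrite lt_min => /andP[ne nd].
apply: le_trans (hausdorff_pre_le (ltW s0) r0 _ EU Ur) _; last first.
  by rewrite lee_fin ltW.
move=> n0; rewrite leNgt; apply/negP => dr.
move: nd; rewrite ltNge => /negP; apply.
apply: (@le_trans _ _ (rho `^ s)); first by rewrite le_powRl ?ltW.
by rewrite ler_peMl ?(ltW rs0) // ler1n.
Qed.

(** For s > 1, covers of the unit interval by at most 3N sets of size 1/N contradict
    [dcov_lower]. *)
Lemma hausdorff_dim_le1 E : (forall x, E x -> 0 <= x <= 1) ->
  (hausdorff_dim E <= 1)%E.
Proof.
move=> E01; rewrite leNgt; apply/negP => h1.
have [s s1 sh] : exists2 s : R, 1 < s & (s%:E < hausdorff_dim E)%E.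
  move: h1; case: (hausdorff_dim E) => [h|_|//]; last by exists 2; rewrite ?ltry ?ltr1n.
  by rewrite lte_fin => h1; exists ((1 + h) / 2); rewrite ?lte_fin; lra.
have s0 : 0 < s by lra.
have [c c0 cP] := dcov_lower s0 sh.
have s1' : 0 < s - 1 by lra.
have [N NP] := exists_large_powR (3 / c) s1'.
have N0 : (0 : R) < N.+1%:R by rewrite ltr0n.
have N1 : (1 : R) <= N.+1%:R by rewrite ler1n.
have cov : dcov N.+1%:R^-1 (3 * N.+1%:R) E.
  apply: dcov_sub (@dcov_itv _ N.+1%:R^-1 0 1 E _ _ _) => //.
  - by rewrite invrK mulr1; lra.
  - by move=> x /E01; rewrite add0r.
have r01 : 0 < (N.+1%:R^-1 : R) <= 1 by rewrite invr_gt0 N0 invf_le1.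
have := cP _ _ r01 cov; rewrite invrK => H.
have := NP N.+1 (leqnSn _); rewrite ltNge => /negP; apply.
rewrite ler_pdivlMr // mulrC -(ler_pM2r N0) -mulrA.
rewrite -[X in _ * (_ * X)](powRr1 (ltW N0)) -powRD ?(gt_eqF N0) ?implybT //.
by rewrite subrK.
Qed.

(** All selected numbers lie within 1 + B above the smallest one, a range with at most 2 + B
    integers. *)
Lemma count_spread (D : seq nat) (P : pred nat) (B : R) : uniq D -> 0 <= B ->
  {in D &, forall a b, P a -> P b -> (a < b)%N -> b%:R - a%:R - 1 <= B} ->
  (count P D)%:R <= 2 + B.
Proof.
move=> uD B0 PB; rewrite -size_filter.
set t := [seq _ <- D | _].
have ut : uniq t by exact: seq.filter_uniq.
have [t0|[b bt]] : t = [::] \/ exists b, b \in t.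
  by case: t {ut} => [|b t']; [left | right; exists b; rewrite mem_head].
  by rewrite t0 addr_ge0.
have [a at' amin] := @ex_minnP (fun a => a \in t) (ex_intro _ b bt).
apply: (@le_trans _ _ ((Num.truncn B).+2%:R)); last first.
  have : (Num.truncn B)%:R <= B by rewrite truncn_le.
  by rewrite -!natr1; lra.
rewrite ler_nat -(size_iota a (Num.truncn B).+2).
apply: uniq_leq_size => // d dt; rewrite mem_iota amin //=.
have [->|ad] := eqVneq d a; first by rewrite -addSnnS ltn_addr.
have lt_ad : (a < d)%N by rewrite ltn_neqAle eq_sym ad amin.
move: (at') (dt); rewrite !mem_filter => /andP[Pa aD] /andP[Pd dD].
have := PB a d aD dD Pa Pd lt_ad.
rewrite (_ : d%:R - a%:R - 1 = (d - a - 1)%N%:R); last first.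
  by rewrite !natrB // ?subn_gt0 // ltnW.
by rewrite -truncn_ge_nat // => le; lia.
Qed.

End CoveringLowerBound.

Section SpectrumLowerBound.
Variables (R : realType) (I : set nat).
Hypothesis I0 : I `<=` [set n | (0 < n)%N].
Implicit Types (rho m s c L C x y z : R).
Let F := cf_set R I.

Lemma dcov_ge1 rho m (A : set R) x : A x -> dcov rho m A -> 1 <= m.
Proof.
move=> Ax [n [U [nm AU _]]]; have [i ii _] := AU x Ax.
by apply: le_trans nm; rewrite ler1n (leq_ltn_trans _ ii).
Qed.

(** The gap between the cylinders is 1/(n+1) - 1/n', a fraction with denominator (n+1) n' <= N^2. *)
Lemma moeb1_sep n n' (N : nat) y y' : (0 < n)%N -> (n < n')%N -> (n' <= N)%N ->
  0 <= y <= 1 -> 0 <= y' <= 1 ->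
  n'%:R - n%:R - 1 <= N%:R ^+ 2 * `|moeb [:: n] y - moeb [:: n'] y'|.
Proof.
move=> n0 nn' n'N /andP[y0 y1] /andP[y0' y1'] /=.
have n1 : (1 : R) <= n%:R by rewrite ler1n.
have n1' : n%:R + 1 <= n'%:R :> R by rewrite natr1 ler_nat.
have nN : n'%:R <= N%:R :> R by rewrite ler_nat.
apply: (@le_trans _ _ (N%:R ^+ 2 * ((n%:R + 1)^-1 - n'%:R^-1))); last first.
  rewrite ler_wpM2l ?exprn_ge0 //; apply: le_trans (ler_norm _).
  by apply: lerB; rewrite lef_pV2 ?posrE; lra.
have -> : (n%:R + 1)^-1 - n'%:R^-1 = (n'%:R - n%:R - 1) / ((n%:R + 1) * n'%:R) :> R.
  by field; apply/andP; split; apply: lt0r_neq0; lra.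
rewrite mulrCA ler_peMr ?subr_ge0 //; first by lra.
rewrite ler_pdivlMr ?mul1r ?mulr_gt0 //; try lra.
by rewrite expr2; apply: ler_pM; lra.
Qed.

(* Double counting of the pairs (cylinder, covering set) that meet. *)
Lemma counting_lower (D : seq nat) (N : nat) rho m L (A : set R) : uniq D ->
  {in D, forall n, 0 < n <= N}%N -> 0 <= L -> 0 <= rho ->
  {in D, forall n, moeb [:: n] @` F `<=` A} ->
  {in D, forall n m', dcov rho m' (moeb [:: n] @` F) -> L <= m'} ->
  dcov rho m A -> (size D)%:R * L <= m * (2 + N%:R ^+ 2 * rho).
Proof.
move=> uD DN L0 r0 DA DL [k [U [km AU Ur]]].
pose hit i n := `[< exists2 z, (moeb [:: n] @` F) z & U i z >].
pose T := \sum_(n <- D) \sum_(i <- iota 0 k) (hit i n)%:R : R.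
apply: (@le_trans _ _ T).
  rewrite /T mulr_natl -[size D]count_predT -iter_addr_0 -big_const_seq.
  rewrite big_seq [leRHS]big_seq; apply: ler_sum => n nD.
  apply: (DL n nD).
  (* The sets hitting the cylinder of [n] cover it, so there are at least [L] of them. *)
  have cov : {in [seq i <- iota 0 k | hit i n], forall i, dcov rho 1 (U i)}.
    move=> i _; exists 1%N, (fun=> U i); split => //; last by move=> _; exact: Ur.
    by move=> z Uz; exists 0%N.
  apply: dcov_sub (dcov_seq cov).
    move=> z zF; have [i ik Uz] := AU z (DA n nD z zF).
    exists i => //; rewrite mem_filter mem_iota /= ik andbT.
    by apply/asboolP; exists z.
  rewrite big_filter big_mkcond; apply: ler_sum => i _; by case: ifP.
have -> : T = \sum_(i <- iota 0 k) (count (hit i) D)%:R.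
  by rewrite /T exchange_big /=; apply: eq_bigr => i _; rewrite sum_indic.
apply: (@le_trans _ _ (k%:R * (2 + N%:R ^+ 2 * rho))); last first.
  by rewrite ler_wpM2r // addr_ge0 // mulr_ge0 ?exprn_ge0.
rewrite -[X in X%:R * _](size_iota 0) mulr_natl -count_predT -iter_addr_0.
rewrite -big_const_seq; apply: ler_sum => i _.
(* Digits whose cylinders meet one covering set differ by at most 1 + N^2 rho. *)
apply: count_spread => //; first by rewrite mulr_ge0 ?exprn_ge0.
move=> a b aD bD /asboolP[_ [y yF <-] Uy] /asboolP[_ [y' yF' <-] Uy'] ab.
have /andP[a0 aN] := DN a aD; have /andP[b0 bN] := DN b bD.
apply: le_trans (moeb1_sep a0 ab bN (cf_set_itv yF) (cf_set_itv yF')) _.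
by rewrite ler_wpM2l ?exprn_ge0 // ltW // (Ur i).
Qed.

(** Blowing the cylinder up to [F] stretches distances by at most 4 N^2, hence the scale 4 N^2
    rho. *)
Lemma cylinder_lower s c rho n N m : 0 < c ->
  (forall rho m, 0 < rho <= 1 -> dcov rho m F -> c * rho^-1 `^ s <= m) ->
  (0 < n <= N)%N -> 0 < rho -> 4 * N%:R ^+ 2 * rho <= 1 ->
  dcov rho m (moeb [:: n] @` F) -> c * (4 * N%:R ^+ 2 * rho)^-1 `^ s <= m.
Proof.
move=> c0 cP /andP[n0 nN] r0 r1 cov.
have pn : posw [:: n] by rewrite /posw /= n0.
have Nn := leq_trans n0 nN; have N0 : (0 : R) < N%:R by rewrite ltr0n.
apply: cP; first by rewrite r1 !mulr_gt0 ?exprn_gt0.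
have c1 : 0 < (4 * N%:R ^+ 2)^-1 :> R by rewrite invr_gt0 mulr_gt0 ?exprn_gt0.
rewrite -[4 * N%:R ^+ 2]invrK mulrC; apply: dcov_preimage cov => //.
move=> y y' yF yF'; apply: le_trans (moeb_dist_ge pn (cf_set_itv yF) (cf_set_itv yF')).
rewrite ler_wpM2r // cyl1 invfM mulrC ler_pM2r ?invr_gt0 //.
rewrite lef_pV2 ?posrE ?exprn_gt0 ?ltr0n // lerXn2r ?nnegrE ?ler0n //.
by rewrite ler_nat.
Qed.

Lemma cf_set_nonempty n : I n -> exists x, F x.
Proof.
by move=> nI; exists (cfval R (fun=> n)); rewrite /F cf_setE //; exists (fun=> n).
Qed.

Lemma exponent_le (a b C : R) :
  (forall N0, exists2 N : nat, (N0 <= N)%N & N%:R `^ a <= C * N%:R `^ b) -> a <= b.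
Proof.
move=> H; rewrite leNgt; apply/negP => ba.
have ab : 0 < a - b by rewrite subr_gt0.
have [N0 N0P] := exists_large_powR C ab.
have [N] := H (maxn 1 N0); rewrite geq_max => /andP[N1 NN].
have Npos : (0 : R) < N%:R by rewrite ltr0n.
rewrite leNgt => /negP; apply; rewrite -ltr_pdivlMr ?powR_gt0 //.
by rewrite -powRB ?(gt_eqF Npos) ?implybT // N0P.
Qed.

(** If u > v, an e of at most (u - v) / (2 (|k| + 1)) keeps e k below u - v, whatever the sign of
    k. *)
Lemma le_perturb (u v k e0 : R) : 0 < e0 ->
  (forall e, 0 < e < e0 -> u <= v + e * k) -> u <= v.
Proof.
move=> e00 H; rewrite leNgt; apply/negP => vu.
have k0 : 0 < 2 * (`|k| + 1) by rewrite mulr_gt0 // ltr_wpDl.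
pose e := Num.min (e0 / 2) ((u - v) / (2 * (`|k| + 1))).
have e1 : 0 < e by rewrite lt_min !divr_gt0 // subr_gt0.
have e2 : e <= (u - v) / (2 * (`|k| + 1)) by rewrite ge_min lexx orbT.
have e3 : e < e0 by rewrite gt_min; apply/orP; left; lra.
have := H e; rewrite e1 e3 => /(_ isT).
rewrite ler_pdivlMr // in e2.
have : e * k <= e * `|k| by rewrite ler_wpM2l ?(ltW e1) // ler_norm.
by lra.
Qed.

Hypothesis lim1 :
  limn_esup (fun N : nat => (ln (count_upto I N)%:R / ln N%:R : R)%:E) = 1%E.

(* With r = N^(2e-1) the ball of radius r around a point of the N-th scale
   contains the cylinders of about N^(1-e) digits between 1/r and N. *)
Lemma admissible_counting theta alpha C e (L : nat -> R) (N0 : nat) :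
  0 < theta < 1 -> 0 < C -> 0 < e < 1 / 2 ->
  (forall x r : R, F x -> 0 < r <= 1 ->
        (covering_number (r `^ theta^-1) (ball x r `&` F)
           <= (C * r `^ (alpha * (1 - theta^-1)))%:E)%E) ->
  (forall N, (N0 <= N)%N -> 0 <= L N /\ forall n m, (0 < n <= N)%N -> I n ->
     dcov (2 * (N%:R `^ ((2 * e - 1) * theta^-1))) m (moeb [:: n] @` F) ->
     L N <= m) ->
  forall N1, exists2 N : nat, (N1 <= N)%N &
    N%:R `^ (1 - e) / 2 * L N <= C * N%:R `^ ((2 * e - 1) * (alpha * (1 - theta^-1))) *
      (2 + N%:R ^+ 2 * (2 * (N%:R `^ ((2 * e - 1) * theta^-1)))).
Proof.
move=> /andP[t0 t1] C0 /andP[e0 e2] adm LP N1.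
have e01 : 0 < e < 1 by apply/andP; split; lra.
have [N2 N2P] := exists_large_powR 2 e0.
have [N NN dens] := density_frequently (maxn (maxn 1 N0) (maxn N1 N2)) e01 lim1.
move: NN; rewrite !geq_max => /andP[/andP[Npos' NN0] /andP[NN1 NN2]].
exists N => //; have Npos : (0 : R) < N%:R by rewrite ltr0n.
have Nge1 : (1 : R) <= N%:R by rewrite ler1n.
have [L0 LN] := LP N NN0.
set r := N%:R `^ (2 * e - 1).
have r0 : 0 < r by exact: powR_gt0.
have r1 : r <= 1 by rewrite -[leRHS](powRr0 N%:R) ler_powR //; lra.
have rV : r^-1 = N%:R `^ (1 - 2 * e).
  by rewrite /r -powRN; congr (_ `^ _); ring.
rewrite !(powRrM N%:R (2 * e - 1)) -/r.
have Ne : 2 <= N%:R `^ e by rewrite ltW // N2P.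
(* Discarding the digits up to 1/r puts the remaining cylinders inside (0, r), so all of them lie in
   one ball. *)
pose D := [seq n <- alph I N | r^-1 < n%:R].
(* At most 1/r = N^(1-2e) digits are discarded, no more than half of N^(1-e) because N^e >= 2. *)
have sizeD : N%:R `^ (1 - e) / 2 <= (size D)%:R.
  have : (size (alph I N))%:R <= (size D)%:R + r^-1.
    rewrite -(count_predC (fun n => r^-1 < n%:R)) natrD /D size_filter lerD2l.
    rewrite -size_filter; apply: (@le_trans _ _ (Num.truncn r^-1)%:R).
      rewrite ler_nat -(size_iota 1 (Num.truncn _)).
      apply: uniq_leq_size; first by rewrite seq.filter_uniq // alph_uniq.
      move=> n; rewrite mem_filter mem_alph /= -leNgt => /and4P[nr _ n0 _].
      by rewrite mem_iota n0 /= add1n ltnS truncn_ge_nat // invr_ge0 ltW.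
    by rewrite truncn_le invr_ge0 ltW.
  have : r^-1 <= N%:R `^ (1 - e) / 2.
    rewrite ler_pdivlMr // rV.
    have -> : N%:R `^ (1 - e) = N%:R `^ (1 - 2 * e) * N%:R `^ e.
      by rewrite -powRD ?(gt_eqF Npos) ?implybT //; congr (_ `^ _); ring.
    by rewrite ler_pM2l // powR_gt0.
  lra.
have [n nD] : exists n, n \in D.
  case: D sizeD => [|n D' _]; last by exists n; rewrite mem_head.
  by rewrite leNgt divr_gt0 // powR_gt0.
have DP k : k \in D -> [/\ I k, (0 < k <= N)%N & r^-1 < k%:R].
  by rewrite mem_filter mem_alph => /and3P[-> /set_mem Ik ->].
have [nI _ _] := DP n nD.
have [y yF] := cf_set_nonempty nI.
have small k z : k \in D -> (moeb [:: k] @` F) z -> 0 < z < r.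
  move=> /DP[_ /andP[k0 _] rk] [w [/andP[w0 _] _] <-] /=.
  have k1 : (1 : R) <= k%:R by rewrite ler1n.
  rewrite invr_gt0 -[r]invrK ltf_pV2 ?posrE ?invr_gt0 //; lra.
have inF k : k \in D -> moeb [:: k] @` F `<=` F.
  move=> /DP[kI _ _] _ [w wF <-]; apply: (cf_set_moeb I0 _ wF).
  by move=> j; rewrite inE => /eqP ->.
pose x := moeb [:: n] y.
have xD : (moeb [:: n] @` F) x by exists y.
have r01 : 0 < r <= 1 by rewrite r0.
have cov := dcov_covering_number (adm x r (inF n nD x xD) r01).
apply: le_trans (counting_lower (D := D) (N := N) (L := L N) _ _ L0 _ _ _ cov).
- by rewrite ler_wpM2r.
- by rewrite seq.filter_uniq // alph_uniq.
- by move=> k /DP[].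
- by rewrite mulr_ge0 // powR_ge0.
- move=> k kD z zk; split; last exact: inF zk.
  have /andP[z0 zr] := small k z kD zk; have /andP[x0 xr] := small n x nD xD.
  by rewrite /ball /= ltr_norml; lra.
- move=> k kD m' cov'; have [kI kN _] := DP k kD.
  by apply: LN kN kI _; rewrite powRrM.
Qed.

(** One set per cylinder is enough here: up to the loss in e, N^2 rho >= 1, so a covering set meets
    O(N^2 rho) cylinders. The exponents of N give 1/theta - 1 <= alpha (1/theta - 1) as e tends to
    0. *)
Lemma admissible_ge1 theta alpha C : 1 / 2 <= theta -> theta < 1 -> 0 < C ->
  (forall x r : R, F x -> 0 < r <= 1 ->
        (covering_number (r `^ theta^-1) (ball x r `&` F)
           <= (C * r `^ (alpha * (1 - theta^-1)))%:E)%E) ->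
  1 <= alpha.
Proof.
move=> t2 t1 C0 adm; have t0 : 0 < theta by lra.
have ti1 : 1 < theta^-1 by rewrite invf_gt1.
have ti2 : theta^-1 <= 2 by rewrite -[2]invrK lef_pV2 ?posrE ?invr_gt0 //; lra.
have t01 : 0 < theta < 1 by rewrite t0.
suff : 1 * (theta^-1 - 1) <= alpha * (theta^-1 - 1) by rewrite ler_pM2r ?subr_gt0.
rewrite mul1r.
apply: (@le_perturb _ _ (1 + 2 * theta^-1 - 2 * alpha * (theta^-1 - 1)) (1 / 2)).
  by lra.
move=> e e01; have /andP[e0 e2] := e01.
have LP N : (0 <= N)%N -> 0 <= (1 : R) /\ forall n m, (0 < n <= N)%N -> I n ->
     dcov (2 * (N%:R `^ ((2 * e - 1) * theta^-1))) m (moeb [:: n] @` F) -> 1 <= m.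
  move=> _; split => // n m _ nI; have [y yF] := cf_set_nonempty nI.
  by apply: (@dcov_ge1 _ _ _ (moeb [:: n] y)); exists y.
have := admissible_counting t01 C0 e01 adm LP => H.
suff : 1 - e <= (2 * e - 1) * (alpha * (1 - theta^-1)) + (2 + (2 * e - 1) * theta^-1).
  by lra.
apply: (@exponent_le _ _ (8 * C)) => N1.
have [N] := H (maxn 1 N1); rewrite geq_max => /andP[N1' NN] h.
exists N => //; have Npos : (0 : R) < N%:R by rewrite ltr0n.
have Nge1 : (1 : R) <= N%:R by rewrite ler1n.
rewrite mulr1 in h; rewrite [in leRHS]powRD ?(gt_eqF Npos) ?implybT //.
have q1 : N%:R ^+ 2 * N%:R `^ ((2 * e - 1) * theta^-1) =
          N%:R `^ (2 + (2 * e - 1) * theta^-1).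
  by rewrite powRD ?(gt_eqF Npos) ?implybT // powR_mulrn // ltW.
have q2 : 1 <= N%:R `^ (2 + (2 * e - 1) * theta^-1).
  rewrite -[leLHS](powRr0 N%:R) ler_powR //.
  have : (1 - 2 * e) * theta^-1 <= 1 * 2 by apply: ler_pM; lra.
  lra.
rewrite [N%:R ^+ 2 * _]mulrCA q1 in h.
set p := N%:R `^ ((2 * e - 1) * _) in h *; set q := N%:R `^ (2 + _) in h q2 *.
have p0 : 0 <= C * p by rewrite mulr_ge0 ?powR_ge0 // ltW.
have : C * p * (2 + 2 * q) <= C * p * (4 * q) by rewrite ler_wpM2l //; lra.
lra.
Qed.

(** With N^2 rho = N^-d each cylinder needs about N^(ds) sets, and a set meets a bounded number of
    cylinders. The exponents of N give 1 + s (1/theta - 2) <= alpha (1/theta - 1) as e tends to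
    0. *)
Lemma admissible_ge theta alpha C s : 0 < theta < 1 / 2 -> 0 < C -> 0 < s ->
  (s%:E < hausdorff_dim F)%E ->
  (forall x r : R, F x -> 0 < r <= 1 ->
        (covering_number (r `^ theta^-1) (ball x r `&` F)
           <= (C * r `^ (alpha * (1 - theta^-1)))%:E)%E) ->
  s + theta / (1 - theta) * (1 - s) <= alpha.
Proof.
move=> /andP[t0 t2] C0 s0 sh adm.
have ti2 : 2 < theta^-1 by rewrite -[2]invrK ltf_pV2 ?posrE ?invr_gt0 //; lra.
have t01 : 0 < theta < 1 by rewrite t0; lra.
have [c c0 cP] := dcov_lower s0 sh.
suff : (s + theta / (1 - theta) * (1 - s)) * (theta^-1 - 1) <= alpha * (theta^-1 - 1).
  by rewrite ler_pM2r // subr_gt0; lra.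
have -> : (s + theta / (1 - theta) * (1 - s)) * (theta^-1 - 1) = 1 + s * (theta^-1 - 2).
  by field; rewrite (gt_eqF t0) /=; apply: lt0r_neq0; lra.
(* The bound on e is what makes [d] below positive. *)
apply: (@le_perturb _ _ (1 + 2 * s * theta^-1 - 2 * alpha * (theta^-1 - 1))
   ((theta^-1 - 2) / (2 * theta^-1))).
  by rewrite divr_gt0 ?subr_gt0 // mulr_gt0 // invr_gt0.
move=> e /andP[e0]; rewrite ltr_pdivlMr; last by rewrite mulr_gt0 // invr_gt0.
move=> et.
have e2 : e < 1 / 2.
  rewrite -(ltr_pM2r (_ : 0 < 2 * theta^-1)); first by lra.
  by rewrite mulr_gt0 // invr_gt0.
have e01 : 0 < e < 1 / 2 by rewrite e0.
pose d := (1 - 2 * e) * theta^-1 - 2.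
have d0 : 0 < d by rewrite /d; lra.
have [N0 N0P] := exists_large_powR 8 d0.
(* The 8 is the 4 of [cylinder_lower] times the 2 lost in passing from balls to sets of small
   diameter. *)
pose L (N : nat) := c * (8 * N%:R `^ (- d))^-1 `^ s.
have Nd (N : nat) : (0 < N)%N ->
    N%:R ^+ 2 * (2 * (N%:R `^ ((2 * e - 1) * theta^-1))) = 2 * N%:R `^ (- d) :> R.
  move=> N1; have Npos : (0 : R) < N%:R by rewrite ltr0n.
  rewrite mulrCA -powR_mulrn ?(ltW Npos) // -powRD ?(gt_eqF Npos) ?implybT //.
  by congr (_ * _ `^ _); rewrite /d; ring.
have Ns (N : nat) : (maxn 1 N0 <= N)%N -> 8 * N%:R `^ (- d) <= 1 :> R.
  rewrite geq_max => /andP[N1 NN]; have Npos : (0 : R) < N%:R by rewrite ltr0n.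
  by rewrite powRN ler_pdivrMr ?powR_gt0 // mul1r ltW // N0P.
have LP N : (maxn 1 N0 <= N)%N -> 0 <= L N /\ forall n m, (0 < n <= N)%N -> I n ->
     dcov (2 * (N%:R `^ ((2 * e - 1) * theta^-1))) m (moeb [:: n] @` F) -> L N <= m.
  move=> NN; split; first by rewrite mulr_ge0 ?powR_ge0 // ltW.
  move=> n m nN nI cov; have := Ns N NN.
  move: NN; rewrite geq_max => /andP[N1 _]; have Npos : (0 : R) < N%:R by rewrite ltr0n.
  have E : 8 * N%:R `^ (- d) = 4 * N%:R ^+ 2 * (2 * (N%:R `^ ((2 * e - 1) * theta^-1))).
    by rewrite -mulrA Nd // mulrA -natrM.
  rewrite /L E => le1; apply: cylinder_lower nN _ le1 cov => //.
  by rewrite mulr_gt0 // powR_gt0.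
have H := admissible_counting t01 C0 e01 adm LP.
suff : 1 - e + d * s <= (2 * e - 1) * (alpha * (1 - theta^-1)) by rewrite /d; lra.
apply: (@exponent_le _ _ (2 * C * 3 * 8 `^ s / c)) => N1.
have [N] := H (maxn (maxn 1 N0) N1); rewrite !geq_max => /andP[/andP[N1' NN0] NN].
have Npos : (0 : R) < N%:R by rewrite ltr0n.
have Nge1 : (1 : R) <= N%:R by rewrite ler1n.
rewrite Nd // /L => h; exists N => //.
rewrite powRD ?(gt_eqF Npos) ?implybT //.
have le8 := Ns N (introT idP (eq_trans (geq_max _ _ _) (introT andP (conj N1' NN0)))).
move: h; rewrite invfM powRM ?invr_ge0 ?powR_ge0 // -powRN opprK -powRrM powRV //.
have p8 : 0 < 8 `^ s :> R by exact: powR_gt0.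
set p := N%:R `^ (1 - e); set q := N%:R `^ (d * s).
set z := N%:R `^ ((2 * e - 1) * _) => h.
have z0 : 0 <= C * z by rewrite mulr_ge0 ?powR_ge0 // ltW.
have h2 : C * z * (2 + 2 * N%:R `^ (- d)) <= C * z * 3 by rewrite ler_wpM2l //; lra.
have := le_trans h h2.
rewrite (_ : p / 2 * (c * ((8 `^ s)^-1 * q)) = p * q * (c / (2 * 8 `^ s))); last first.
  by field; rewrite gt_eqF.
rewrite -ler_pdivlMr ?divr_gt0 ?mulr_gt0 // => h3.
apply: le_trans h3 _; rewrite le_eqVlt; apply/orP; left; apply/eqP.
by field; rewrite !gt_eqF.
Qed.

End SpectrumLowerBound.

(** * The formula for the Assouad spectrum *)

Unset Implicit Arguments.

Theorem proposition6p2 (R : realType) (I : set nat)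
  (I_pos : I `<=` [set n | (0 < n)%N])
  (I_limsup :
     limn_esup (fun N : nat => (ln (count_upto I N)%:R / ln N%:R : R)%:E) = 1%E) :
  let h := hausdorff_dim (cf_set R I) in
  forall theta : R, 0 < theta < 1 ->
    assouad_spectrum theta (cf_set R I) =
      (if (theta < 1 / 2)%R
       then h + (theta / (1 - theta))%:E * (1 - h)
       else 1)%E.
Proof.
move=> h theta t01; have /andP[t0 t1] := t01.
have F01 x : cf_set R I x -> 0 <= x <= 1 by exact: cf_set_itv.
have h1 : (h <= 1)%E := hausdorff_dim_le1 F01.
(* A null exponent s' < 1/2 contradicts [null_exponent_ge_half] at the midpoint of s' and 1/2. *)
have hhalf : ((1 / 2)%:E <= h)%E.
  rewrite leNgt; apply/negP => /ereal_inf_lt[_ [s' [s'0 null] <-]].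
  rewrite lte_fin => s'2.
  have s's : s' < (s' + 1 / 2) / 2 by lra.
  by have := null_exponent_ge_half I_pos s'0 null I_limsup s's; lra.
have [h0 hE] : exists h0 : R, h = h0%:E.
  move: h1 hhalf; case: h => // h0 _ _; by exists h0.
rewrite hE !lee_fin in h1 hhalf *.
have -> : (h0%:E + (theta / (1 - theta))%:E * (1 - h0%:E) =
    (h0 + theta / (1 - theta) * (1 - h0))%R%:E)%E by [].
case: ifPn => [t2|]; last first.
  rewrite -leNgt => t2; apply/eqP; rewrite eq_le spectrum_le1 //=.
  apply: le_ereal_inf_tmp => _ [alpha [C [C0 adm]] <-].
  have alpha1 := admissible_ge1 I_pos I_limsup t2 t1 C0 adm.
  by rewrite lee_fin.
have t02 : 0 < theta < 1 / 2 by rewrite t0.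
pose k := theta / (1 - theta).
have k0 : 0 < k by rewrite divr_gt0 // subr_gt0.
have k1 : k < 1 by rewrite ltr_pdivrMr ?subr_gt0 //; lra.
apply/eqP; rewrite eq_le; apply/andP; split.
  (* At h = 1 there is no exponent s with h < s <= 1, but the formula is then the trivial bound. *)
  have [h01|h01] := leP 1 h0.
    have -> : h0 = 1 by apply/eqP; rewrite eq_le h1.
    by rewrite subrr mulr0 addr0 spectrum_le1.
  apply/lee_addgt0Pr => eps eps0; rewrite -EFinD.
  (* A null exponent below h0 + e is combined with s = h0 + 2e: the second bound keeps s <= 1, the
     first keeps the error 2e within eps / 2. *)
  pose e := Num.min (eps / 4) ((1 - h0) / 4).
  have e0 : 0 < e by rewrite lt_min !divr_gt0 // subr_gt0.
  have e1 : e <= eps / 4 by rewrite ge_min lexx.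
  have e2 : e <= (1 - h0) / 4 by rewrite ge_min lexx orbT.
  have : (h < (h0 + e)%:E)%E by rewrite hE lte_fin ltrDl.
  move=> /ereal_inf_lt[_ [s' [s'0 null] <-]]; rewrite lte_fin => s'h.
  have s'1 : s' < h0 + 2 * e by lra.
  have s1 : h0 + 2 * e <= 1 by lra.
  have eps2 : 0 < eps / 2 by rewrite divr_gt0.
  apply: le_trans (spectrum_le_small_theta I_pos I_limsup t02 s'0 s'1 s1 eps2 null) _.
  rewrite lee_fin -/k.
  have : k * e >= 0 by rewrite mulr_ge0 // ltW.
  by lra.
apply: le_ereal_inf_tmp => _ [alpha [C [C0 adm]] <-]; rewrite lee_fin -/k.
rewrite -subr_ge0; apply/ler_addgt0Pr => eps eps0.
(* As h0 >= 1/2, the exponent h0 - e stays positive, and using it lowers the formula by at most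
   e. *)
pose e := Num.min eps (1 / 4).
have e0 : 0 < e by rewrite lt_min eps0 divr_gt0.
have e1 : e <= eps by rewrite ge_min lexx.
have e2 : e <= 1 / 4 by rewrite ge_min lexx orbT.
have s0 : 0 < h0 - e by lra.
have sh : ((h0 - e)%:E < h)%E by rewrite hE lte_fin ltrBlDr ltrDl.
have := admissible_ge I_pos I_limsup t02 C0 s0 sh adm; rewrite -/k => le.
have : k * e >= 0 by rewrite mulr_ge0 // ltW.
by lra.
Qed.
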